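(* Let $\Gamma=(X,A)$, $\delta X\subsetneq X$, $w$, $V$, $\mathcal{M}_V$, $\chi$ be as in the context, and enumerate $X\setminus\delta X=\{u_1,\dots,u_n\}$. Let $z\in\mathbb{C}$ be such that $\chi\mathcal{M}_V\chi^*-zI$ is invertible, and put $G_z=(\chi\mathcal{M}_V\chi^*-zI)^{-1}$, a matrix indexed by $X\setminus\delta X$. Then $\iota_1(z;\mathcal{H}_L(\Gamma;\delta X))\neq 0$, $\iota_1(z;\mathcal{H}_Q(\Gamma;\delta X))\neq 0$, and for all $u_\ell,u_m\in X\setminus\delta X$ (equal or not), $$G_z(u_\ell,u_m)=\frac{\iota_2(z;\mathcal{H}_L(\Gamma;\delta X;\ell,m))}{\iota_1(z;\mathcal{H}_L(\Gamma;\delta X))}=\frac{\iota_2(z;\mathcal{H}_Q(\Gamma;\delta X;\ell,m))}{\iota_1(z;\mathcal{H}_Q(\Gamma;\delta X))}.$$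
   Context: Setting. $\Gamma=(X,A)$ is a finite connected symmetric digraph: each arc $a\in A$ has an origin $o(a)$ and a terminus $t(a)$, and there is a distinguished inverse arc $\bar a\in A$ with $o(\bar a)=t(a)$, $t(\bar a)=o(a)$, $\bar{\bar a}=a$; multiple arcs are allowed, self-loops are not. The undirected edge supporting $a$ is $|a|=|\bar a|$, and $E=\{|a|:a\in A\}$ (a multigraph edge set). A boundary $\delta X\subsetneq X$ (possibly empty) is fixed. Given an edge weight $w:E\to\mathbb{C}$ and a potential $V:X\to\mathbb{C}$, define $(Mf)(u)=\sum_{a\in A,\,t(a)=u}w(|a|)f(o(a))$ for $f\in\mathbb{C}^X$, and $\mathcal{M}_V=M+V$, where $V$ acts by multiplication $(Vf)(u)=V(u)f(u)$. $\chi:\mathbb{C}^X\to\mathbb{C}^{X\setminus\delta X}$ is restriction and $\chi^*$ is extension by zero, so $\chi\mathcal{M}_V\chi^*$ is the principal submatrix of $\mathcal{M}_V$ indexed by $X\setminus\delta X$. Put $\pi(u)=\sum_{a\in A,\,t(a)=u}w(|a|)$. Deformed graph. $\mathring\Gamma$ is the undirected multigraph with vertex set $X$ and edge set $E\cup S$, where $S=\{\sigma_u:u\in X\setminus\delta X\}$ and $\sigma_u$ is a new self-loop at $u$. A spanning subgraph of $\mathring\Gamma$ has vertex set $X$ and edge set a subset of $E\cup S$; $S(H)$ denotes its self-loops. A self-loop counts as a cycle of length $1$ (two parallel edges form a cycle of length 2). A tree is a connected graph with no cycle (in particular no self-loop; an isolated vertex is a tree). An odd unicyclic graph is a connected graph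 containing exactly one cycle, of odd length (a tree with exactly one self-loop attached is odd unicyclic). Families of spanning subgraphs. For $J\in\{L,Q\}$, $\mathcal{H}_J(\Gamma;\delta X)$ is the set of spanning subgraphs $H$ of $\mathring\Gamma$ such that every connected component $W$ of $H$ satisfies: (i) if $W$ contains a vertex of $\delta X$, then it contains exactly one vertex of $\delta X$ and $W$ is a tree; (ii) otherwise, for $J=L$, $W$ is a tree together with exactly one self-loop, and for $J=Q$, $W$ is odd unicyclic. For $u_\ell,u_m\in X\setminus\delta X$ (possibly equal), $\mathcal{H}_J(\Gamma;\delta X;\ell,m)$ is the set of spanning subgraphs $H$ of $\mathring\Gamma$ such that every component $W$ satisfies: (i)' if $W$ contains a vertex of $\delta X$, then it contains exactly one, contains neither $u_\ell$ nor $u_m$, and is a tree; (ii)' if $W$ contains $u_\ell$ or $u_m$, then it contains both, contains no vertex of $\delta X$, and is a tree (no self-loop); (iii)' otherwise, for $J=L$, $W$ is a tree with exactly one self-loop, and for $J=Q$, $W$ is odd unicyclic. Weights. For $z\in\mathbb{C}$: $w_L(z;e)=-w(e)$ and $w_Q(z;e)=w(e)$ for $e\in E$; $w_L(z;\sigma_u)=-z+V(u)+\pi(u)$ and $w_Q(z;\sigma_u)=-z+V(u)-\pi(u)$ for $u\in X\setminus\delta X$. For a subgraph $H$, $W_J(z;H)=\prod_{e\in E(H)}w_J(z;e)$ (product over all edges of $H$ including self-loops). Let $b(H)$ be the number of connected components of $H$ containing a cycle of length $\ge 3$, and for $H\in\mathcal{H}_Q(\Gamma;\delta X;\ell,m)$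 let $\mathrm{dist}_H(u_\ell,u_m)$ be the graph distance in $H$ (they lie in a common tree). Define $\iota_1(z;\mathcal{H}_L(\Gamma;\delta X))=\sum_{H\in\mathcal{H}_L(\Gamma;\delta X)}W_L(z;H)$, $\iota_1(z;\mathcal{H}_Q(\Gamma;\delta X))=\sum_{H\in\mathcal{H}_Q(\Gamma;\delta X)}4^{b(H)}W_Q(z;H)$, $\iota_2(z;\mathcal{H}_L(\Gamma;\delta X;\ell,m))=\sum_{H\in\mathcal{H}_L(\Gamma;\delta X;\ell,m)}W_L(z;H)$, $\iota_2(z;\mathcal{H}_Q(\Gamma;\delta X;\ell,m))=\sum_{H\in\mathcal{H}_Q(\Gamma;\delta X;\ell,m)}4^{b(H)}(-1)^{\mathrm{dist}_H(u_\ell,u_m)}W_Q(z;H)$. *)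

(* Defs.v *)
From mathcomp Require Import all_boot all_algebra.
From mathcomp Require Export complex.
From mathcomp Require Export reals.

Set Implicit Arguments.
Unset Strict Implicit.
Unset Printing Implicit Defensive.
Import GRing.Theory Num.Theory.
Local Open Scope ring_scope.

Section Green.

Variables (X A : finType) (o t : A -> X) (inv : A -> A).

Definition edge (a : A) : {set A} := [set a; inv a].

Definition Eset : {set {set A}} := [set edge a | a in A].

Definition adjG : rel X := fun x y => [exists a, (o a == x) && (t a == y)].

Definition symmetric_digraph : Prop :=
  [/\ forall a, inv (inv a) = a,
      forall a, o (inv a) = t a,
      forall a, t (inv a) = o a &
      forall a, o a != t a (* no self-loops *) ].

Definition connected_graph : Prop := forall u v : X, connect adjG u v.

Variable dX : {set X}.

(* A spanning subgraph of the deformed graph: a set F of edges of Gamma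
   (F \subset Eset) together with a set S of interior vertices u, standing
   for the self-loops sigma_u (S \subset ~: dX). *)
Definition subgraph := ({set {set A}} * {set X})%type.

Definition spanning (H : subgraph) : bool :=
  (H.1 \subset Eset) && (H.2 \subset ~: dX).

Definition arcH (H : subgraph) (a : A) : bool := edge a \in H.1.

(* adjacency in H (self-loops do not connect anything) *)
Definition adjH (H : subgraph) : rel X :=
  fun x y => [exists a, [&& arcH H a, o a == x & t a == y]].

Definition compH (H : subgraph) (u : X) : {set X} := [set v | connect (adjH H) u v].
Definition comps (H : subgraph) : {set {set X}} := [set compH H u | u in X].

(* C is the edge set of a cycle of H of length >= 2 lying in W: there is a
   closed walk a_1 ... a_k (k >= 2) of arcs of H with pairwise distinct
   edges and pairwise distinct vertices, whose edge set is C.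
   (Length-1 cycles are exactly the self-loops, handled separately.) *)
Definition arc_cycle (H : subgraph) (W : {set X}) (C : {set {set A}}) : bool :=
  [exists k : 'I_#|A|.+1, exists s : k.-tuple A,
     [&& (1 < k)%N,
         all (arcH H) s,
         all (fun a => o a \in W) s,
         cycle (fun a b => t a == o b) s,
         uniq (map edge s),
         uniq (map o s) &
         C == [set edge a | a in s]]].

Definition cycles_in (H : subgraph) (W : {set X}) : {set {set {set A}}} :=
  [set C | arc_cycle H W C].

Definition loops_in (H : subgraph) (W : {set X}) : {set X} := H.2 :&: W.

Definition ncycles (H : subgraph) (W : {set X}) : nat :=
  #|loops_in H W| + #|cycles_in H W|.

(* for a component W: W is a tree *)
Definition is_tree (H : subgraph) (W : {set X}) : bool := ncycles H W == 0%N.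

Definition tree_one_loop (H : subgraph) (W : {set X}) : bool :=
  (#|cycles_in H W| == 0%N) && (#|loops_in H W| == 1%N).

Definition odd_unicyclic (H : subgraph) (W : {set X}) : bool :=
  (ncycles H W == 1%N) &&
  ((#|loops_in H W| == 1%N) || [exists C in cycles_in H W, odd #|C|]).

(* J = L (true) or J = Q (false) *)
Definition Jcond (J : bool) (H : subgraph) (W : {set X}) : bool :=
  if J then tree_one_loop H W else odd_unicyclic H W.

Definition HJ (J : bool) (H : subgraph) : bool :=
  spanning H &&
  [forall W in comps H,
     if W :&: dX != set0 then (#|W :&: dX| == 1%N) && is_tree H W
     else Jcond J H W].

Definition HJlm (J : bool) (ul um : X) (H : subgraph) : bool :=
  spanning H &&
  [forall W in comps H,
     if W :&: dX != set0 then
       [&& #|W :&: dX| == 1%N, ul \notin W, um \notin W & is_tree H W]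
     else if (ul \in W) || (um \in W) then
       [&& ul \in W, um \in W & is_tree H W]
     else Jcond J H W].

Definition bH (H : subgraph) : nat :=
  #|[set W in comps H | [exists C in cycles_in H W, (2 < #|C|)%N]]|.

Fixpoint walkn (H : subgraph) (n : nat) (u v : X) : bool :=
  match n with
  | 0 => u == v
  | n'.+1 => [exists a, [&& arcH H a, o a == u & walkn H n' (t a) v]]
  end.

(* graph distance in H: least n with a walk of length n (u, v connected) *)
Definition distH (H : subgraph) (u v : X) : nat :=
  find (fun n => walkn H n u v) (iota 0 #|X|.+1).

Variable R : realType.
Local Notation C := R[i].
Variables (w : {set A} -> C) (V : X -> C).

Definition piw (u : X) : C := \sum_(a | t a == u) w (edge a).

Definition wJedge (J : bool) (e : {set A}) : C := if J then - w e else w e.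
Definition wJloop (J : bool) (z : C) (u : X) : C :=
  if J then - z + V u + piw u else - z + V u - piw u.

Definition WJ (J : bool) (z : C) (H : subgraph) : C :=
  (\prod_(e in H.1) wJedge J e) * \prod_(u in H.2) wJloop J z u.

Definition iota1 (J : bool) (z : C) : C :=
  \sum_(H : subgraph | HJ J H)
     (if J then 1 else 4 ^+ bH H) * WJ J z H.

Definition iota2 (J : bool) (z : C) (ul um : X) : C :=
  \sum_(H : subgraph | HJlm J ul um H)
     (if J then 1 else 4 ^+ bH H * (-1) ^+ distH H ul um) * WJ J z H.

(* M_V as a matrix indexed by X: (M f)(u) = sum_{t a = u} w|a| f(o a) *)
Definition MV (u v : X) : C :=
  \sum_(a | (t a == u) && (o a == v)) w (edge a) + (if u == v then V u else 0).

Definition uenum (i : 'I_#|~: dX|) : X := enum_val i.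

Definition Mz (z : C) : 'M[C]_#|~: dX| :=
  \matrix_(i, j) (MV (uenum i) (uenum j) - (i == j)%:R * z).

End Green.

(* Main.v *)
Require Import Defs.
From mathcomp Require Import all_fingroup all_boot all_algebra.
From mathcomp Require Import complex reals.
From mathcomp Require Import zify ring.

Set Implicit Arguments.
Unset Strict Implicit.
Unset Printing Implicit Defensive.
Import GRing.Theory Num.Theory.

(** Take s = -1 for J = L and s = 1 for J = Q, give an edge e = {u, v} the
    vector b_e = delta_v + s delta_u (up to sign) and a self-loop at u the
    vector delta_u.  Replacing the rows of M_V - z indexed by dX by rows of the
    identity yields a matrix (sum_k c_k b_k b_k^T) to which the Cauchy-Binet
    formula applies; a boundary vertex then behaves exactly like a vertex with a
    self-loop, so a subgraph becomes a pair (F, T) of edges and roots.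

    The square determinant attached to (F, T) is computed by removing edges.  A
    leaf v outside T with edge e gives the same determinant, up to sign, as
    (F - e, T + v).  If there is no such leaf, counting degrees shows that F is
    a disjoint union of cycles avoiding T, and telescoping along a cycle through
    an edge e at v gives the factor 1 - (-s)^k in front of the determinant of
    (F - e, T + v): the factor is 0 or +-2.  Hence the squared determinant is
    4^b on the families H_J and 0 elsewhere.

    A cofactor (m, l) is a determinant of the same kind where the root m is
    replaced by l in one of the two Cauchy-Binet factors; the cofactors of a row
    are transported by -s along the edges of F, which yields (-s)^dist. *)

(** * Cycles, leaves and components *)

Section Graph.

Variables (X A : finType) (o t : A -> X) (inv : A -> A).
Hypothesis symG : symmetric_digraph o t inv.

Local Notation edge := (edge inv).

Implicit Types (F : {set {set A}}) (T W : {set X}) (C : {set {set A}}) (s : seq A).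

Definition arcs F : {pred A} := [pred a | edge a \in F].
(** Adjacency and cycles of length at least 2 are determined by the edge set, so fixing the loop set
    to [set0] gives notions of [F] alone, convertible with those of any [(F, S)]. *)
Definition component F x : {set X} := compH o t inv (F, set0) x.
Definition cycs F W : {set {set {set A}}} := cycles_in o t inv (F, set0) W.
(** Without self-loop arcs, an edge has exactly one arc starting at each of its ends, so the size of
    this set is the degree of [x] in [F]. *)
Definition out F x : {set A} := [set a in arcs F | o a == x].

Definition iscycle F s : bool :=
  [&& 1 < size s, all (arcs F) s, cycle (fun a b => t a == o b) s,
      uniq (map edge s) & uniq (map o s)].

Lemma invK a : inv (inv a) = a. Proof. by case: symG. Qed.
Lemma o_inv a : o (inv a) = t a. Proof. by case: symG. Qed.
Lemma t_inv a : t (inv a) = o a. Proof. by case: symG. Qed.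
Lemma o_neq_t a : o a != t a. Proof. by case: symG. Qed.

Lemma inv_neq a : inv a != a.
Proof. by apply: contraNneq (o_neq_t a) => ia; rewrite -{1}ia o_inv. Qed.

Lemma edge_inv a : edge (inv a) = edge a.
Proof. by rewrite /Defs.edge invK setUC. Qed.

Lemma edge_eqP a b : reflect (b = a \/ b = inv a) (edge a == edge b).
Proof.
apply: (iffP eqP) => [eab|[]->]; rewrite ?edge_inv //.
by have : b \in edge a; [rewrite eab set21|case/set2P; [left|right]].
Qed.

Lemma edge_same_o a b : edge a = edge b -> o a = o b -> a = b.
Proof.
move/eqP/edge_eqP => [->//|-> oab]; move: (o_neq_t a).
by rewrite -o_inv -oab eqxx.
Qed.

Lemma in_out F x a : (a \in out F x) = (edge a \in F) && (o a == x).
Proof. by rewrite inE. Qed.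

Lemma adjHP F x y :
  reflect (exists a, [/\ edge a \in F, o a = x & t a = y])
          (adjH o t inv (F, set0) x y).
Proof.
apply: (iffP existsP) => [[a /and3P[Fa /eqP ox /eqP ty]]|[a [Fa ox ty]]].
  by exists a.
by exists a; rewrite /arcH /= Fa ox ty !eqxx.
Qed.

Lemma connect_adj_sym F : connect_sym (adjH o t inv (F, set0)).
Proof.
apply: sym_connect_sym => x y; apply/adjHP/adjHP => -[a [Fa <- <-]];
by exists (inv a); rewrite edge_inv o_inv t_inv.
Qed.

Lemma in_comp F x y : (y \in component F x) = connect (adjH o t inv (F, set0)) x y.
Proof. by rewrite inE. Qed.

Lemma comp_refl F x : x \in component F x.
Proof. by rewrite in_comp connect0. Qed.

Lemma comp_eqP F x y : reflect (component F x = component F y) (y \in component F x).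
Proof.
apply: (iffP idP) => [xy|->]; last exact: comp_refl.
apply/setP => z; rewrite !in_comp; move: xy; rewrite in_comp => xy.
exact: (same_connect (connect_adj_sym F) xy).
Qed.

Lemma comp_arc F a : edge a \in F -> component F (o a) = component F (t a).
Proof.
by move=> Fa; apply/comp_eqP; rewrite in_comp connect1 //; apply/adjHP; exists a.
Qed.

Lemma comp_min F x (S : {set X}) :
  x \in S -> (forall a, edge a \in F -> o a \in S -> t a \in S) ->
  component F x \subset S.
Proof.
move=> xS clS; apply/subsetP => y; rewrite in_comp => xy.
have clo : closed (adjH o t inv (F, set0)) (mem S).
  move=> u v /adjHP[a [Fa <- <-]]; apply/idP/idP; first exact: clS.
  by rewrite -(o_inv a) -(t_inv a); apply: clS; rewrite edge_inv.
by have := closed_connect clo xy; rewrite xS => /esym.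
Qed.

Lemma comp_sub F F' x : F' \subset F -> component F' x \subset component F x.
Proof.
move=> sF; apply: comp_min; first exact: comp_refl.
move=> a /(subsetP sF) Fa /comp_eqP xo.
by apply/comp_eqP; rewrite xo comp_arc.
Qed.

Lemma comp_out0 F x : out F x = set0 -> component F x = [set x].
Proof.
move=> o0; apply/eqP; rewrite eqEsubset sub1set comp_refl andbT.
apply: comp_min => [|a Fa]; rewrite inE // => /eqP oa.
have : a \in out F x by rewrite in_out Fa oa eqxx.
by rewrite o0 in_set0.
Qed.

Lemma cycsP F W C :
  reflect (exists s, [/\ iscycle F s, {in s, forall a, o a \in W}
                       & C = [set edge a | a in s]])
          (C \in cycs F W).
Proof.
rewrite inE; apply: (iffP existsP) => [[k /existsP[s]]|[s [cs sW ->]]].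
  case/and5P=> k1 arcs_s sW cyc_s /and3P[ue uo /eqP ->]; exists s; split => //.
    by apply/and5P; split; rewrite ?size_tuple.
  by apply/allP.
(* Distinct edges force distinct arcs, so the length respects the bound built into [arc_cycle]. *)
have sz : size s < #|A|.+1.
  case/and5P: cs => _ _ _ _ /map_uniq/card_uniqP <-.
  by rewrite ltnS max_card.
exists (Ordinal sz); apply/existsP; exists (in_tuple s) => /=.
case/and5P: cs => -> arcs_s -> -> -> /=; rewrite eqxx !andbT.
by apply/andP; split => //; apply/allP.
Qed.

Lemma uniq_map_inj (I J : eqType) (f : I -> J) (r : seq I) :
  uniq (map f r) -> {in r &, injective f}.
Proof.
elim: r => [|x r IHr] //= /andP[fx ur] u v; rewrite !inE.
case/predU1P=> [->|ru] /predU1P[->|rv] // fuv.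
- by case/mapP: fx; exists v.
- by case/mapP: fx; exists u.
- exact: IHr.
Qed.

(** Edges do not repeat along the cycle, so a predecessor over the same edge would be [a] itself,
    and [a] would be a self-loop. *)
Lemma iscycle_prev F s a : iscycle F s -> a \in s ->
  exists b, [/\ b \in s, t b = o a & edge b != edge a].
Proof.
case/and5P=> _ _ cyc_s ue uo sa; exists (prev s a).
have /eqP tb := prev_cycle cyc_s sa.
have bs : prev s a \in s by rewrite mem_prev.
split=> //; apply: contraNneq (o_neq_t a) => /(uniq_map_inj ue bs sa) eba.
by rewrite -[in t a]eba tb.
Qed.

Lemma iscycle_next F s a : iscycle F s -> a \in s ->
  exists2 b, b \in s & o b = t a.
Proof.
case/and5P=> _ _ cyc_s ue uo sa; exists (next s a); first by rewrite mem_next.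
by have /eqP := next_cycle cyc_s sa.
Qed.

Lemma iscycle_arc F s a : iscycle F s -> a \in s -> edge a \in F.
Proof. by case/and5P=> _ /allP sF _ _ _ /sF. Qed.

Lemma iscycle_sub F F' s :
  iscycle F s -> (forall a, a \in s -> edge a \in F') -> iscycle F' s.
Proof.
by case/and5P=> s1 _ cs ue uo sF'; apply/and5P; split => //; apply/allP.
Qed.

Lemma iscycle_comp F s a : iscycle F s -> a \in s ->
  {in s, forall b, o b \in component F (o a)}.
Proof.
move=> cs sa b sb; have /and5P[_ _ cyc_s _ _] := cs.
have cc : cycle (fun a b => component F (o a) == component F (o b)) s.
  apply: (@sub_in_cycle _ (mem s)) cyc_s; last by apply/allP.
  move=> x y /= sx _ /eqP xy; rewrite -xy; apply/eqP/comp_arc.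
  exact: iscycle_arc sx.
apply/comp_eqP; have := connect_cycle cc sa sb.
have clo : closed (fun a b => component F (o a) == component F (o b))
             [pred c | component F (o a) == component F (o c)].
  by move=> x y /eqP; rewrite !inE => ->.
by move=> /(closed_connect clo); rewrite !inE eqxx => /esym/eqP.
Qed.

Lemma cycs_comp F s a : iscycle F s -> a \in s ->
  [set edge a | a in s] \in cycs F (component F (o a)).
Proof.
by move=> cs sa; apply/cycsP; exists s; split => //; apply: iscycle_comp sa.
Qed.

Lemma card_cycle F s : iscycle F s -> #|[set edge a | a in s]| = size s.
Proof.
case/and5P=> _ _ _ ue _; rewrite card_in_imset; last exact: uniq_map_inj.
exact/card_uniqP/(map_uniq ue).
Qed.

(** Iterating the choice of a next arc gives a walk that never backtracks. By finiteness an origin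
    repeats, and the stretch closed by the first repetition is a cycle. *)
Lemma exists_cycle F a0 : edge a0 \in F ->
  (forall a, edge a \in F ->
     exists b, [/\ edge b \in F, o b = t a & edge b != edge a]) ->
  exists s, iscycle F s.
Proof.
move=> Fa0 next_ex.
pose nx a := odflt a
  [pick b | [&& edge b \in F, o b == t a & edge b != edge a]].
have nxP a : edge a \in F ->
    [/\ edge (nx a) \in F, o (nx a) = t a & edge (nx a) != edge a].
  move=> /next_ex[b [Fb ob eb]]; rewrite /nx; case: pickP => [c|/(_ b)] /=.
    by case/and3P=> ? /eqP.
  by rewrite Fb ob eqxx eb.
pose f i := iter i nx a0.
have fF i : edge (f i) \in F by elim: i => [|i IHi] //=; case: (nxP _ IHi).
have fo i : o (f i.+1) = t (f i) by case: (nxP _ (fF i)).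
have fe i : edge (f i.+1) != edge (f i) by case: (nxP _ (fF i)).
clearbody f; clear nx nxP.
(* Here origin [j] has occurred before; the least such [j] makes all earlier origins pairwise
   distinct. *)
pose P j := [exists i : 'I_j, o (f i) == o (f j)].
have exP : exists j, P j.
  have /injectivePn[p [q npq opq]] :
      ~~ injectiveb (fun i : 'I_#|X|.+1 => o (f i)).
    by apply/injectiveP => /leq_card; rewrite card_ord ltnn.
  have [lt_pq|lt_qp|eq_pq] := ltngtP p q.
  - by exists q; apply/existsP; exists (Ordinal lt_pq); rewrite opq.
  - by exists p; apply/existsP; exists (Ordinal lt_qp); rewrite opq.
  - by case/eqP: npq; apply: val_inj.
case: (ex_minnP exP) => j /existsP[[i lt_ij] /= /eqP oij] jmin.
have o_inj p q : p < q -> q < j -> o (f p) <> o (f q).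
  move=> lt_pq lt_qj opq.
  have : P q by apply/existsP; exists (Ordinal lt_pq); rewrite opq.
  by move/jmin; rewrite leqNgt lt_qj.
(* A stretch of length 1 would be a self-loop. *)
have lt_i1j : i.+1 < j.
  rewrite ltn_neqAle lt_ij andbT; apply: contraNneq (o_neq_t (f i)) => ij.
  by rewrite oij -ij fo.
exists (map f (iota i (j - i))); apply/and5P; split.
- by rewrite size_map size_iota ltn_subRL addn1.
- by apply/allP => _ /mapP[k _ ->]; exact: fF.
- have -> : j - i = (j - i.+1).+1 by rewrite subnSK.
  have path_f k p : path (fun a b => t a == o b) (f p) (map f (iota p.+1 k)).
    by elim: k p => [|k IHk] p //=; rewrite fo eqxx IHk.
  have last_f k p : last (f p) (map f (iota p.+1 k)) = f (p + k).
    by elim: k p => [|k IHk] p /=; rewrite ?addn0 // IHk addSnnS.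
  rewrite /= rcons_path path_f last_f.
  by rewrite -fo oij -addnS subnSK // subnKC ?eqxx // (ltnW lt_ij).
- rewrite -map_comp map_inj_in_uniq ?iota_uniq //.
  (* Two arcs over one edge are either equal, which repeats an origin, or inverse; minimality then
     makes them consecutive, which is backtracking. *)
  have eq_lt p q : p < q -> q < j -> edge (f p) <> edge (f q).
    move=> lt_pq lt_qj /eqP/edge_eqP[fqp|fqp].
      by apply: (o_inj p q) => //; rewrite fqp.
    have oq : o (f p.+1) = o (f q) by rewrite fo fqp o_inv.
    have [lt_p1q|le_qp1] := ltnP p.+1 q; first exact: o_inj oq.
    have qp : q = p.+1 by apply/eqP; rewrite eqn_leq le_qp1 lt_pq.
    by have := fe p; rewrite -qp fqp edge_inv eqxx.
  move=> p q; rewrite !mem_iota subnKC ?(ltnW lt_ij) // => /andP[_ pj] /andP[_ qj] /= epq.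
  have [lt_pq|lt_qp|//] := ltngtP p q; first by case: (eq_lt p q).
  by case: (eq_lt q p).
- rewrite -map_comp map_inj_in_uniq ?iota_uniq //.
  move=> p q; rewrite !mem_iota subnKC ?(ltnW lt_ij) // => /andP[_ pj] /andP[_ qj] /= epq.
  have [lt_pq|lt_qp|//] := ltngtP p q; first by case: (o_inj p q).
  by case: (o_inj q p).
Qed.

Lemma card_edge a : #|edge a| = 2.
Proof. by rewrite /Defs.edge cards2 eq_sym inv_neq. Qed.

Lemma edge_fiber a : [set b | edge b == edge a] = edge a.
Proof.
by apply/setP => b; rewrite !inE; apply/edge_eqP/orP => -[]; 
   [move->; left|move->; right|move/eqP->; left|move/eqP->; right];
   rewrite ?invK.
Qed.

(** Handshake lemma: the arcs over [F] are counted by origin on one side and by edge on the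
    other. *)
Lemma sum_out F : F \subset Eset inv -> \sum_x #|out F x| = 2 * #|F|.
Proof.
move=> sFE; have -> : 2 * #|F| = \sum_(e in F) #|[set a | edge a == e]|.
  rewrite mulnC -sum_nat_const; apply: eq_bigr => e /(subsetP sFE)/imsetP[a _ ->].
  by rewrite edge_fiber card_edge.
transitivity #|arcs F|.
  rewrite -sum1_card (partition_big o xpredT) //=; apply: eq_bigr => x _.
  by rewrite -sum1_card; apply: eq_bigl => a; rewrite in_out.
rewrite -sum1_card (partition_big edge (mem F)) //=; apply: eq_bigr => e Fe.
rewrite -sum1_card; apply: eq_bigl => a; rewrite !inE.
by case: eqP => [->|]; rewrite ?andbF // Fe.
Qed.

(** The inverse of [a] already leaves [t a]; a degree other than 1 provides another arc there, and
    distinct arcs with one origin lie over distinct edges. *)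
Lemma next_arc F a : edge a \in F -> #|out F (t a)| != 1 ->
  exists b, [/\ edge b \in F, o b = t a & edge b != edge a].
Proof.
move=> Fa n1; have ia : inv a \in out F (t a) by rewrite in_out edge_inv Fa o_inv eqxx.
have /set0Pn[b] : out F (t a) :\ inv a != set0.
  by apply: contraNneq n1 => o0; rewrite (cardsD1 (inv a)) ia o0 cards0.
rewrite in_setD1 in_out => /and3P[bia Fb /eqP ob]; exists b; split => //.
apply: contraNneq bia => eba; apply/eqP/edge_same_o; first by rewrite edge_inv.
by rewrite o_inv.
Qed.

Lemma cycs_mono F F' W W' :
  F' \subset F -> W' \subset W -> cycs F' W' \subset cycs F W.
Proof.
move=> sF sW; apply/subsetP => C /cycsP[s [cs sW' ->]]; apply/cycsP; exists s.
split=> // [|a sa]; last exact/(subsetP sW)/sW'.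
by apply: (iscycle_sub cs) => a sa; apply/(subsetP sF)/(iscycle_arc cs).
Qed.

Lemma cycsT F W : cycs F W \subset cycs F setT.
Proof. exact/cycs_mono/subsetT. Qed.

Lemma iscycle_ex F s : iscycle F s -> exists a, a \in s.
Proof. by case/and5P; case: s => [|a s] // _ _ _ _ _; exists a; rewrite mem_head. Qed.

(** * Removing the edge at a leaf *)

Section Leaf.

Variables (F : {set {set A}}) (v : X) (a0 : A).
Hypothesis leaf_v : out F v = [set a0].
Local Notation F' := (F :\ edge a0).

Lemma leaf_arc : edge a0 \in F /\ o a0 = v.
Proof.
have : a0 \in out F v by rewrite leaf_v set11.
by rewrite in_out => /andP[? /eqP].
Qed.

Lemma leaf_eq a : edge a \in F -> o a = v -> a = a0.
Proof. by move=> Fa oa; apply/set1P; rewrite -leaf_v in_out Fa oa eqxx. Qed.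

Lemma leaf_out : out F' v = set0.
Proof.
apply/setP => a; rewrite in_out !inE; apply/negP => /andP[/andP[nea Fa] /eqP oa].
by rewrite (leaf_eq Fa oa) eqxx in nea.
Qed.

Lemma comp_leaf x : x != v -> component F' x = component F x :\ v.
Proof.
move=> xv; have [Fa0 oa0] := leaf_arc.
have vx : v \notin component F' x.
  apply: contra xv => /comp_eqP exv.
  by rewrite -in_set1 -(comp_out0 leaf_out) -exv comp_refl.
apply/eqP; rewrite eqEsubset; apply/andP; split.
  apply/subsetP => y xy; rewrite in_setD1.
  rewrite (subsetP (comp_sub x (subsetDl _ _)) _ xy) andbT.
  by apply: contraNneq vx => <-.
rewrite subDset.
(* Adding [v] exactly when its only neighbour [t a0] is reached makes the set closed under the arcs
   of [F]. *)
pose S := component F' x :|: [set y | (y == v) && (t a0 \in component F' x)].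
have inS y : (y \in S) = (y \in component F' x) || (y == v) && (t a0 \in component F' x).
  by rewrite in_setU [in X in _ || X]in_set.
suff : component F x \subset S.
  move/subset_trans; apply; rewrite setUC /S setUS //.
  by apply/subsetP => y; rewrite !inE => /andP[].
apply: comp_min => [|a Fa]; first by rewrite in_setU comp_refl.
have [/eqP/edge_eqP [ea|ea]|nea] := eqVneq (edge a) (edge a0).
- by rewrite -ea oa0 !inS eqxx (negPf vx) /= => ->.
- have -> : o a = t a0 by rewrite ea t_inv.
  have -> : t a = v by rewrite -oa0 ea o_inv.
  by rewrite !inS eqxx /= => /orP[->|/andP[_ ->]]; rewrite orbT.
have Fa' : edge a \in F' by rewrite in_setD1 nea.
have oav : o a != v.
  by apply: contraNneq nea => oav; rewrite (leaf_eq Fa oav).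
rewrite !inS (negPf oav) orbF => /comp_eqP oax.
by apply/orP; left; rewrite oax comp_arc // comp_refl.
Qed.

(** A cycle through [v] would enter and leave it by two distinct edges. *)
Lemma iscycle_leaf s : iscycle F s ->
  forall a, a \in s -> o a != v /\ edge a != edge a0.
Proof.
move=> cs; have ov a : a \in s -> o a != v.
  move=> sa; apply/eqP => oa; have [b [sb tb eba]] := iscycle_prev cs sa.
  have ea : a = a0 := leaf_eq (iscycle_arc cs sa) oa.
  have ib : inv b = a0.
    by apply: leaf_eq; rewrite ?edge_inv ?(iscycle_arc cs sb) // o_inv tb.
  by rewrite ea -ib edge_inv eqxx in eba.
move=> a sa; split; first exact: ov.
apply/eqP => /eqP/edge_eqP[ea|ea].
  by have /eqP := ov _ sa; rewrite -ea; case: leaf_arc.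
have [b sb ob] := iscycle_next cs sa; have /eqP := ov _ sb; apply.
by rewrite ob -o_inv -ea; case: leaf_arc.
Qed.

Lemma cycs_leaf W : cycs F' (W :\ v) = cycs F W.
Proof.
apply/eqP; rewrite eqEsubset cycs_mono ?subsetDl //=.
apply/subsetP => C /cycsP[s [cs sW ->]]; apply/cycsP; exists s; split => //.
  apply: (iscycle_sub cs) => a sa; have [_ ea] := iscycle_leaf cs sa.
  by rewrite in_setD1 ea (iscycle_arc cs sa).
by move=> a sa; rewrite in_setD1 sW // andbT; case: (iscycle_leaf cs sa).
Qed.

Lemma cycsT_leaf : cycs F' setT = cycs F setT.
Proof.
apply/eqP; rewrite eqEsubset cycs_mono ?subsetDl //=.
by rewrite -[cycs F _]cycs_leaf; apply: cycs_mono; rewrite ?subsetT.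
Qed.

End Leaf.

(* [T] consists of the boundary and of the vertices carrying a self-loop; only
   their union matters in the conditions on a component [W]. *)
Definition cond (J : bool) F T W : bool :=
  (#|T :&: W| == 1) && (cycs F W == set0)
  || [&& ~~ J, T :&: W == set0, #|cycs F W| == 1
       & [exists C in cycs F W, odd #|C|]].

Definition good J F T : bool := [forall x, cond J F T (component F x)].

Lemma goodP J F T : reflect (forall x, cond J F T (component F x)) (good J F T).
Proof. exact: forallP. Qed.

(** Without its edge, [v] is isolated and forms a valid component once it becomes a root. The other
    components at most lose [v] and keep their roots and cycles. *)
Lemma good_leaf J F T v a0 : out F v = [set a0] -> v \notin T ->
  good J F T = good J (F :\ edge a0) (v |: T).
Proof.
move=> leaf_v vT.
have condE x : x != v -> cond J (F :\ edge a0) (v |: T) (component (F :\ edge a0) x)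
                        = cond J F T (component F x).
  move=> xv; rewrite (comp_leaf leaf_v xv) /cond (cycs_leaf leaf_v).
  suff -> : (v |: T) :&: (component F x :\ v) = T :&: component F x by [].
  apply/setP => y; rewrite !inE; case: eqP => [->|] //=.
  by rewrite (negPf vT).
have [Fa0 oa0] := leaf_arc leaf_v.
apply/goodP/goodP => gd x.
  have [->|xv] := eqVneq x v; last by rewrite condE.
  apply/orP; left; rewrite (comp_out0 (leaf_out leaf_v)).
  have -> : (v |: T) :&: [set v] = [set v].
    by apply/setP => y; rewrite !inE; case: eqP; rewrite ?andbF.
  rewrite cards1 eqxx -subset0; apply/subsetP => C /cycsP[s [cs sv _]].
  have [a sa] := iscycle_ex cs; have := sv a sa; rewrite inE => /eqP oa.
  have : a \in out (F :\ edge a0) v by rewrite in_out (iscycle_arc cs sa) oa eqxx.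
  by rewrite (leaf_out leaf_v) inE.
have [->|xv] := eqVneq x v; last by rewrite -condE.
rewrite -oa0 (comp_arc Fa0) -condE //.
by rewrite -oa0 eq_sym o_neq_t.
Qed.

Lemma good_root J F T v : good J F T -> v \in T ->
  T :&: component F v = [set v] /\ cycs F (component F v) = set0.
Proof.
move=> /goodP/(_ v) gv vT.
have vTW : v \in T :&: component F v by rewrite inE vT comp_refl.
case/orP: gv => [/andP[/cards1P[y ey] /eqP ->]|/and4P[_ /eqP e0]].
  by split => //; rewrite ey in vTW *; case/set1P: vTW => ->.
by rewrite e0 inE in vTW.
Qed.

(** A component with a root is a tree with that single root, which may sit at any of its vertices.
    Moving it away from a leaf makes [good_leaf] applicable there. *)
Lemma good_move J F T u v : good J F T -> v \in T -> u \in component F v ->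
  (u \notin T :\ v) /\ good J F (u |: T :\ v).
Proof.
move=> gd vT uv; have [TW cW] := good_root gd vT; have /comp_eqP ecuv := uv.
split.
  rewrite in_setD1; apply/negP => /andP[nuv uT].
  by rewrite -in_set1 -TW inE uT uv in nuv.
apply/goodP => x; have [vx|vx] := boolP (v \in component F x).
  move/comp_eqP: vx => ->; rewrite /cond cW eqxx andbT; apply/orP; left.
  suff -> : (u |: T :\ v) :&: component F v = [set u] by rewrite cards1.
  apply/setP => y; rewrite in_setI in_setU1 in_setD1 in_set1.
  have [->|_] /= := eqVneq y u.
    by rewrite uv.
  by have := in_setI y T (component F v); rewrite TW in_set1; case: eqP => //= _ <-.
have ux : u \notin component F x.
  by apply: contra vx => /comp_eqP ->; rewrite -ecuv comp_refl.
have /goodP/(_ x) := gd; rewrite /cond.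
suff -> : (u |: T :\ v) :&: component F x = T :&: component F x by [].
apply/setP => y; rewrite !in_setI in_setU1 in_setD1.
have [->|_] := eqVneq y u; first by rewrite (negPf ux) !andbF.
by have [->|_] := eqVneq y v; rewrite ?(negPf vx) ?andbF.
Qed.

(** * Opening a cycle at one of its edges *)

Section Break.

Variables (F : {set {set A}}) (s : seq A) (a : A).
Hypotheses (cyc_s : iscycle F s) (sa : a \in s).
Local Notation F' := (F :\ edge a).
Local Notation C := [set edge b | b in s].
Local Notation W := (component F (o a)).

(** Rotated to start at [a], the cycle continues as a path from [t a] back to [o a] that avoids the
    edge of [a]. *)
Lemma comp_break_ends : component F' (o a) = component F' (t a).
Proof.
have Fs b : b \in s -> edge b \in F := iscycle_arc cyc_s.
have /and5P[_ _ cs ue _] := cyc_s; have [i p rs] := rot_to sa.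
have sub_p b : b \in p -> b \in s.
  by move=> pb; rewrite -(mem_rot i) rs inE pb orbT.
have F'p b : b \in p -> edge b \in F'.
  move=> pb; rewrite in_setD1 Fs ?sub_p // andbT.
  have : uniq (map edge (a :: p)) by rewrite -rs map_rot rot_uniq.
  by move=> /= /andP[nap _]; apply: contraNneq nap => <-; apply: map_f.
move: cs; rewrite -(rot_cycle i) rs /= rcons_path => /andP[pp /eqP <-].
have gen q : {subset q <= p} -> forall c, path (fun a b => t a == o b) c q ->
    component F' (t (last c q)) = component F' (t c).
  elim: q => [//|b q IHq] qp c /= /andP[/eqP cb pq].
  rewrite (IHq _ b) // => [|d qd]; last by apply: qp; rewrite inE qd orbT.
  by rewrite cb comp_arc // F'p // qp // mem_head.
exact: gen.
Qed.

Lemma comp_break x : component F' x = component F x.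
Proof.
apply/eqP; rewrite eqEsubset comp_sub ?subsetDl //=.
apply: comp_min => [|b Fb]; first exact: comp_refl.
have -> : (t b \in component F' x) = (o b \in component F' x) => //.
have [/eqP/edge_eqP eb|neb] := eqVneq (edge b) (edge a); last first.
  have F'b : edge b \in F' by rewrite in_setD1 neb.
  by apply/comp_eqP/comp_eqP => ->; rewrite comp_arc.
have ab : component F' (o b) = component F' (t b).
  case: eb => eb; have := comp_break_ends; rewrite eb //.
  by rewrite o_inv t_inv.
by apply/comp_eqP/comp_eqP => ->; rewrite ab.
Qed.

Lemma cyc_touch s2 : iscycle F s2 -> edge a \in [set edge b | b in s2] ->
  {in s2, forall b, o b \in W}.
Proof.
move=> cs2 /imsetP[b sb /eqP/edge_eqP eab] c sc.
have -> : W = component F (o b).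
  by case: eab => ->; rewrite // o_inv -comp_arc // (iscycle_arc cyc_s sa).
exact: iscycle_comp sb _ sc.
Qed.

Lemma cond_break_out J T x : o a \notin component F x ->
  cond J F' (o a |: T) (component F x) = cond J F T (component F x).
Proof.
move=> ax; rewrite /cond.
have -> : (o a |: T) :&: component F x = T :&: component F x.
  apply/setP => y; rewrite !in_setI in_setU1.
  by case: eqVneq => [->|//]; rewrite (negPf ax) !andbF.
suff -> : cycs F' (component F x) = cycs F (component F x) by [].
apply/eqP; rewrite eqEsubset cycs_mono ?subsetDl //=.
apply/subsetP => D /cycsP[s2 [cs2 s2x ->]]; apply/cycsP; exists s2; split => //.
apply: (iscycle_sub cs2) => b sb; rewrite in_setD1 (iscycle_arc cs2 sb) andbT.
apply: contra ax => /eqP eb.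
have bW : o b \in W.
  by apply: (cyc_touch cs2 _ sb); rewrite -eb; apply/imsetP; exists b.
move/comp_eqP: (s2x b sb) => ->; move/comp_eqP: bW => <-; exact: comp_refl.
Qed.

(** A cycle excludes the tree alternative of [cond], so the component of [a] is odd unicyclic and
    this is its cycle. *)
Lemma good_cycle J T : good J F T ->
  [/\ ~~ J, T :&: W = set0, cycs F W = [set C] & odd (size s)].
Proof.
move=> /goodP/(_ (o a)); have CW : C \in cycs F W := cycs_comp cyc_s sa.
case/orP=> [/andP[_ /eqP c0]|]; first by rewrite c0 inE in CW.
case/and4P=> nJ /eqP TW /cards1P[D eD] /existsP[D' /andP[]].
rewrite eD in CW *; move/set1P: CW => <-; move/set1P=> ->.
by rewrite -(card_cycle cyc_s).
Qed.

(** Opening the only cycle of the component leaves a connected tree without root, and [o a] becomes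
    its root. *)
Lemma good_break J T : good J F T -> good J F' (o a |: T).
Proof.
move=> gd; have [nJ TW cW _] := good_cycle gd.
apply/goodP => x; rewrite comp_break.
have [ax|ax] := boolP (o a \in component F x); last first.
  by rewrite cond_break_out //; apply/goodP.
move/comp_eqP: ax => ->; apply/orP; left.
have -> : (o a |: T) :&: W = [set o a].
  apply/setP => y; have := in_set0 y; rewrite -TW !in_setI in_setU1 in_set1.
  by have [->|] := eqVneq y (o a); rewrite ?comp_refl.
rewrite cards1 eqxx /= -subset0; apply/subsetP => D F'D.
have := subsetP (cycs_mono (subsetDl _ _) (subxx W)) D F'D.
rewrite cW => /set1P eD; move: F'D; rewrite eD => /cycsP[s2 [cs2 _ Cs2]].
have : edge a \in C by apply/imsetP; exists a.
rewrite Cs2 => /imsetP[b sb eab]; have := iscycle_arc cs2 sb.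
by rewrite -eab in_setD1 eqxx.
Qed.

Lemma good_root_notin J T : good J F T -> o a \notin T.
Proof.
move=> gd; have [_ TW _ _] := good_cycle gd.
by apply/negP => aT; have := in_set0 (o a); rewrite -TW inE aT comp_refl.
Qed.

Lemma cycsT_break J T : good J F T -> #|cycs F setT| = #|cycs F' setT|.+1.
Proof.
move=> gd; have [nJ TW cW _] := good_cycle gd.
have CF : C \in cycs F setT by rewrite (subsetP (cycsT F W)) // cycs_comp.
rewrite (cardsD1 C) CF add1n; congr _.+1; apply: eq_card => D; rewrite in_setD1.
apply/andP/idP => [[neD /cycsP[s2 [cs2 _ eD]]]|F'D].
  apply/cycsP; exists s2; split => //; apply: (iscycle_sub cs2) => b sb.
  rewrite in_setD1 (iscycle_arc cs2 sb) andbT; apply: contraNneq neD => eb.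
  rewrite -in_set1 -cW; apply/cycsP; exists s2; split => //.
  by apply: cyc_touch => //; apply/imsetP; exists b.
split; last exact: subsetP (cycs_mono (subsetDl _ _) (subxx _)) D F'D.
apply/eqP => eD; move: F'D; rewrite eD => /cycsP[s2 [cs2 _ Cs2]].
have : edge a \in C by apply/imsetP; exists a.
rewrite Cs2 => /imsetP[b sb eab]; have := iscycle_arc cs2 sb.
by rewrite -eab in_setD1 eqxx.
Qed.

(* The right-hand side depends on the component only, so that the cycle is the
   only one there. *)
Lemma cycle_fills : (forall x, #|out F x| <= 2) ->
  C = [set edge b | b in [pred b | (edge b \in F) && (o b \in W)]].
Proof.
move=> deg2; have out_s b c : b \in s -> edge c \in F -> o c = o b ->
    edge c \in C /\ exists2 d, d \in s & o d = t c.
  move=> sb Fc oc; have [p [sp tp epb]] := iscycle_prev cyc_s sb.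
  have : c \in [set b; inv p].
    (* The next arc [b] and the reverse of the previous arc [p] are two distinct arcs leaving this
       vertex; the degree bound admits no third. *)
    suff <- : out F (o b) = [set b; inv p] by rewrite in_out Fc oc eqxx.
    apply/esym/eqP; rewrite eqEcard; apply/andP; split.
      apply/subsetP => d /set2P[]->; rewrite in_out ?edge_inv ?o_inv ?tp ?eqxx andbT;
      exact: iscycle_arc cyc_s _.
    rewrite cards2 (leq_trans (deg2 _)) //.
    suff -> : b != inv p by [].
    by apply: contraNneq epb => ->; rewrite edge_inv.
  case/set2P=> ->; split.
  - by apply/imsetP; exists b.
  - by have [d sd od] := iscycle_next cyc_s sb; exists d.
  - by rewrite edge_inv; apply/imsetP; exists p.
  - by exists p; rewrite ?t_inv.
have sW : W \subset [set o b | b in s].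
  apply: comp_min => [|c Fc /imsetP[b sb ocb]]; first by apply/imsetP; exists a.
  by have [_ [d sd od]] := out_s b c sb Fc ocb; apply/imsetP; exists d.
apply/setP => e; apply/imsetP/imsetP => [[b sb ->]|[c]].
  by exists b; rewrite // inE (iscycle_arc cyc_s sb) (iscycle_comp cyc_s sa sb).
rewrite inE => /andP[Fc /(subsetP sW)/imsetP[b sb ocb]] ->.
by have [/imsetP[d sd ->] _] := out_s b c sb Fc ocb; exists d.
Qed.

End Break.

(** Converse of [good_break]. The degree bound makes the component of [a] coincide with its cycle,
    so that restoring the edge creates no second cycle. *)
Lemma good_unbreak F s a J T :
  iscycle F s -> a \in s -> (forall x, #|out F x| <= 2) -> ~~ J ->
  odd (size s) -> o a \notin T ->
  good J (F :\ edge a) (o a |: T) -> good J F T.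
Proof.
move=> cs sa deg2 nJ odd_s aT /goodP gd; apply/goodP => x.
have := gd x; rewrite (comp_break cs sa).
have [ax|ax] := boolP (o a \in component F x); last by rewrite (cond_break_out cs).
move/comp_eqP: ax => -> {x}; rewrite /cond => gda; apply/orP; right.
have aTW : o a \in (o a |: T) :&: component F (o a) by rewrite inE setU11 comp_refl.
rewrite nJ /=; apply/and3P; split.
- case/orP: gda => [/andP[/cards1P[y ey] _]|/and4P[_ /eqP e0]]; last first.
    by rewrite e0 inE in aTW.
  rewrite -subset0; apply/subsetP => z; rewrite in_setI => /andP[zT zW].
  have : z \in (o a |: T) :&: component F (o a) by rewrite in_setI in_setU1 zT zW orbT.
  rewrite ey in aTW *; move/set1P: aTW => <- /set1P eza.
  by rewrite -eza zT in aT.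
- apply/cards1P; exists [set edge b | b in s]; apply/setP => D; rewrite in_set1.
  apply/idP/eqP => [/cycsP[s2 [cs2 s2W ->]]|->]; last exact: cycs_comp.
  have [b sb] := iscycle_ex cs2.
  rewrite (cycle_fills cs2 sb deg2) (cycle_fills cs sa deg2).
  by move/comp_eqP: (s2W b sb) => ->.
- apply/existsP; exists [set edge b | b in s].
  by rewrite cycs_comp //= (card_cycle cs).
Qed.

Lemma cycs_set0 W : cycs set0 W = set0.
Proof.
apply/eqP; rewrite -subset0; apply/subsetP => C /cycsP[s [cs _ _]].
by have [a sa] := iscycle_ex cs; have := iscycle_arc cs sa; rewrite inE.
Qed.

Lemma out_set0 x : out set0 x = set0.
Proof. by apply/setP => a; rewrite in_out !inE. Qed.

Lemma good_no_edge_setT J T : good J set0 T -> T = setT.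
Proof.
move=> /goodP gd; apply/setP => x; have := gd x.
rewrite /cond cycs_set0 cards0 !andbF orbF (comp_out0 (out_set0 x)).
case/andP=> /eqP c1 _; have /card_gt0P[y] : 0 < #|T :&: [set x]| by rewrite c1.
by rewrite in_setI in_setT => /andP[yT /set1P <-].
Qed.

(** Cutting at a leaf or on a cycle trades one edge for one root, until no edge is left and every
    vertex is a root. Hence good subgraphs have the size required of the index sets in the
    Cauchy-Binet sum. *)
Lemma good_card J F T : F \subset Eset inv -> good J F T -> #|F| + #|T| = #|X|.
Proof.
elim: {F}_.+1 {-2}F T (ltnSn #|F|) => // n IHn F T leFn sFE gd.
have cardF' a : edge a \in F -> #|F| = #|F :\ edge a|.+1.
  by move=> Fa; rewrite (cardsD1 (edge a)) Fa.
have [/existsP[v /cards1P[a leaf_v]]|no_leaf] := boolP [exists v, #|out F v| == 1].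
  have [Fa oa] := leaf_arc leaf_v; have cF' := cardF' a Fa.
  have sF'E : F :\ edge a \subset Eset inv := subset_trans (subsetDl _ _) sFE.
  (* A root at the leaf is first moved to the neighbour. *)
  have [vT|vT] := boolP (v \in T).
    have uv : t a \in component F v by rewrite -oa (comp_arc Fa) comp_refl.
    have [uT gd2] := good_move gd vT uv.
    have vT2 : v \notin t a |: T :\ v.
      by rewrite in_setU1 in_setD1 eqxx orbF -oa o_neq_t.
    rewrite (good_leaf _ leaf_v vT2) in gd2.
    have := IHn _ _ _ sF'E gd2; rewrite !cardsU1 vT2 uT (cardsD1 v T) vT cF'; lia.
  rewrite (good_leaf _ leaf_v vT) in gd.
  have := IHn _ _ _ sF'E gd; rewrite cardsU1 vT cF'; lia.
have [F0|[e Fe]] := set_0Vmem F.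
  by move: gd; rewrite F0 => /good_no_edge_setT->; rewrite cards0 cardsT.
have /imsetP[a0 _ ea0] := subsetP sFE _ Fe; rewrite ea0 in Fe.
have [s cs] : exists s, iscycle F s.
  apply: exists_cycle Fe _ => a Fa; apply: next_arc => //.
  by move: no_leaf; rewrite negb_exists => /forallP/(_ (t a)).
have [a sa] := iscycle_ex cs; have Fa := iscycle_arc cs sa.
have aT := good_root_notin cs sa gd; have cF' := cardF' a Fa.
have := IHn _ _ _ (subset_trans (subsetDl _ _) sFE) (good_break cs sa gd).
rewrite cardsU1 aT cF'; lia.
Qed.

(** Each cyclic component contains exactly one cycle; being odd and of length at least 2, it has
    length at least 3 and is counted by [bH]. *)
Lemma bH_cycs F T (S : {set X}) :
  good false F T -> bH o t inv (F, S) = #|cycs F setT|.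
Proof.
(* A cyclic component is mapped to the set of its cycles, a singleton, so cycles are counted as
   singletons. *)
move=> gd; rewrite -(card_imset _ set1_inj).
pose B := [set W in comps o t inv (F, S) | [exists C in cycs F W, 2 < #|C|]].
have BP W : W \in B -> exists s, exists2 a, a \in s &
    [/\ iscycle F s, W = component F (o a) & cycs F W = [set [set edge b | b in s]]].
  rewrite inE => /andP[/imsetP[x _ eW] /existsP[C /andP[/cycsP[s [cs sW _]] _]]].
  have [a sa] := iscycle_ex cs; exists s, a => //.
  have eWa : W = component F (o a).
    rewrite eW; apply/comp_eqP.
    by have := sW a sa; rewrite eW.
  by split => //; rewrite eWa; case: (good_cycle cs sa gd).
have -> : bH o t inv (F, S) = #|B| by [].
rewrite -(@card_in_imset _ _ (cycs F) (mem B)).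
  apply: eq_card => D; apply/imsetP/imsetP => [[W WB ->]|[C /cycsP[s [cs _ ->]] ->]].
    have [s [a sa [cs eW ->]]] := BP W WB; exists [set edge b | b in s] => //.
    by apply/cycsP; exists s; split.
  have [a sa] := iscycle_ex cs; exists (component F (o a)).
    rewrite inE; apply/andP; split; first by apply/imsetP; exists (o a).
    apply/existsP; exists [set edge b | b in s].
    have [_ _ _ odd_s] := good_cycle cs sa gd.
    rewrite cycs_comp //= (card_cycle cs).
    by case/and5P: cs odd_s; case: (s) => [|? [|? []]].
  by case: (good_cycle cs sa gd).
move=> W W' WB W'B eWW'; have [s [a sa [cs Wa eW]]] := BP W WB.
have [s' [a' sa' [cs' Wa' eW']]] := BP W' W'B.
have : edge a \in [set edge b | b in s'].
  have /set1P <- : [set edge b | b in s] \in [set [set edge b | b in s']].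
    by rewrite -eW' -eWW' eW set11.
  by apply/imsetP; exists a.
case/imsetP=> b sb /eqP/edge_eqP eab.
rewrite Wa Wa'; have /comp_eqP -> := iscycle_comp cs' sa' sb.
by case: eab => ->; rewrite // o_inv (comp_arc (iscycle_arc cs sa)).
Qed.

Lemma forall_comps (H : subgraph X A) (P : pred {set X}) :
  [forall W in comps o t inv H, P W] = [forall x, P (component H.1 x)].
Proof.
apply/forall_inP/forallP => [PW x|Px W /imsetP[x _ ->]]; last exact: Px.
by apply: PW; apply/imsetP; exists x.
Qed.

(** * The families of subgraphs in terms of good pairs *)

Section Families.

Variable dX : {set X}.

Lemma card_rootsI (S : {set X}) W : S \subset ~: dX ->
  #|(S :|: dX) :&: W| = #|S :&: W| + #|W :&: dX|.
Proof.
move=> SdX; rewrite setIUl cardsU [dX :&: W]setIC.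
suff -> : S :&: W :&: (W :&: dX) = set0 by rewrite cards0 subn0.
apply/setP => x; rewrite !in_setI in_set0; apply/negP => /andP[/andP[xS _] /andP[_ xd]].
by have := subsetP SdX x xS; rewrite in_setC xd.
Qed.

Lemma HJ_good J (H : subgraph X A) :
  HJ o t inv dX J H = spanning inv dX H && good J H.1 (H.2 :|: dX).
Proof.
rewrite /HJ; case: (boolP (spanning _ _ _)) => //= /andP[_ SdX].
rewrite forall_comps; apply: eq_forallb => x; rewrite /cond.
rewrite /is_tree /Jcond /tree_one_loop /odd_unicyclic /ncycles.
rewrite -/(cycs H.1 _) /loops_in -[cycles_in _ _ _ _ _]/(cycs H.1 _).
rewrite -!cards_eq0 !card_rootsI //.
case: (#|_ :&: dX|) => [|[|q]]; case: (#|H.2 :&: _|) => [|[|p]];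
  case: (#|cycs _ _|) => [|[|c]]; by case: J; rewrite //= ?andbF ?orbF ?andbT.
Qed.

(** A rootless tree becomes good by making either [l] or [m] its root. Conversely, if both choices
    are good, then [l] and [m] share a component: a component with only one of them would have to be
    acyclic and rootless, which the other choice forbids. *)
Lemma HJlm_good J l m (H : subgraph X A) : l \notin dX -> m \notin dX ->
  HJlm o t inv dX J l m H =
  [&& spanning inv dX H, l \notin H.2 :|: dX, m \notin H.2 :|: dX,
      good J H.1 (l |: (H.2 :|: dX)) & good J H.1 (m |: (H.2 :|: dX))].
Proof.
move=> ld md; rewrite /HJlm; case: (boolP (spanning _ _ _)) => //= /andP[_ SdX].
rewrite forall_comps.
have cardU x W : x \notin H.2 :|: dX ->
    #|(x |: (H.2 :|: dX)) :&: W| = (x \in W) + (#|H.2 :&: W| + #|W :&: dX|).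
  move=> xT; rewrite -card_rootsI // setIUl.
  have [xW|xW] := boolP (x \in W).
    rewrite (setIidPl _) ?sub1set // cardsU1; congr (_ + _).
    by rewrite in_setI (negPf xT).
  suff -> : [set x] :&: W = set0 by rewrite set0U.
  by apply/setP => y; rewrite !inE; case: eqP => [->|//]; rewrite (negPf xW).
pose P W := if W :&: dX != set0 then
    [&& #|W :&: dX| == 1, l \notin W, m \notin W & is_tree o t inv H W]
  else if (l \in W) || (m \in W) then
    [&& l \in W, m \in W & is_tree o t inv H W]
  else Jcond o t inv J H W.
have key : l \notin H.2 :|: dX -> m \notin H.2 :|: dX -> forall W,
    P W = cond J H.1 (l |: (H.2 :|: dX)) W && cond J H.1 (m |: (H.2 :|: dX)) W.
  move=> lT mT W; rewrite /P /cond.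
  rewrite /is_tree /Jcond /tree_one_loop /odd_unicyclic /ncycles.
  rewrite /loops_in -[cycles_in _ _ _ _ _]/(cycs H.1 _).
  rewrite -!cards_eq0 !cardU //.
  case: (#|_ :&: dX|) => [|[|q]]; case: (#|H.2 :&: _|) => [|[|p]];
  case: (#|cycs _ _|) => [|[|c]]; case: (l \in W); case: (m \in W);
    by case: (J); rewrite //= ?andbF ?orbF ?andbT ?andbb.
apply/forallP/and4P => [fW|[lT mT /goodP gl /goodP gm] x]; last first.
  by rewrite -/(P (component H.1 x)) key ?gl ?gm.
(* A self-loop at [l] or [m] would keep its component from being a tree. *)
have notinT x : (x == l) || (x == m) -> x \notin H.2 :|: dX.
  move=> xlm; rewrite in_setU negb_or; apply/andP; split; last first.
    by case/pred2P: xlm => ->.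
  apply/negP => xS; have : P (component H.1 x) := fW x; rewrite /P.
  have xloop : 0 < #|loops_in H (component H.1 x)|.
    by apply/card_gt0P; exists x; rewrite in_setI xS comp_refl.
  have -> : is_tree o t inv H (component H.1 x) = false.
    by apply/negbTE; rewrite /is_tree /ncycles addn_eq0 negb_and -lt0n xloop.
  have -> : (l \in component H.1 x) || (m \in component H.1 x).
    by case/pred2P: xlm => <-; rewrite comp_refl ?orbT.
  by rewrite !andbF; case: ifP.
have lT : l \notin H.2 :|: dX by apply: notinT; rewrite eqxx.
have mT : m \notin H.2 :|: dX by apply: notinT; rewrite eqxx orbT.
split=> //; apply/goodP => x; have : P (component H.1 x) := fW x;
by rewrite key // => /andP[].
Qed.

End Families.

End Graph.

(** * The Cauchy-Binet formula *)

Local Open Scope ring_scope.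

Section CauchyBinet.

Variables (R : comNzRingType) (I : finType) (n : nat) (k0 : I).
Implicit Types (S : {set I}).

(** The default [k0] is reached only when [S] has fewer than [n] elements. *)
Definition elt (S : {set I}) (i : 'I_n) : I := nth k0 (enum S) i.

Lemma elt_inj S : #|S| = n -> injective (elt S).
Proof.
move=> Sn i j /eqP; rewrite nth_uniq ?enum_uniq -?cardE ?Sn ?ltn_ord //.
by move/eqP/val_inj.
Qed.

Lemma codom_elt S k : #|S| = n -> (k \in codom (elt S)) = (k \in S).
Proof.
move=> Sn; apply/codomP/idP => [[i ->]|Sk].
  by rewrite -mem_enum mem_nth // -cardE Sn ltn_ord.
have ik : (index k (enum S) < n)%N.
  by rewrite -[n in (_ < n)%N]Sn cardE index_mem mem_enum.
by exists (Ordinal ik); rewrite /elt /= nth_index // mem_enum.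
Qed.

Lemma prod_elt S (f : I -> R) : #|S| = n ->
  \prod_(i < n) f (elt S i) = \prod_(k in S) f k.
Proof.
move=> Sn; rewrite -[RHS]big_enum /= (big_nth k0) -cardE Sn big_mkord.
by [].
Qed.

(** Multilinearity gives a sum over all maps from rows to indices. A non-injective map repeats a row
    and contributes 0; the injective ones are grouped by image, where they are the permutations of
    [elt S]. *)
Lemma cauchy_binet (P Q : I -> 'I_n -> R) :
  \det (\matrix_(i, j) \sum_k P k i * Q k j) =
  \sum_(S : {set I} | #|S| == n)
    \det (\matrix_(i, j) P (elt S i) j) * \det (\matrix_(i, j) Q (elt S i) j).
Proof.
transitivity (\sum_(f : {ffun 'I_n -> I})
    (\prod_i P (f i) i) * \det (\matrix_(i, j) Q (f i) j)).
  rewrite /determinant.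
  under eq_bigr => s _.
    under eq_bigr => i _ do rewrite mxE.
    rewrite bigA_distr_bigA /= big_distrr /=.
    over.
  rewrite exchange_big /=; apply: eq_bigr => f _; rewrite big_distrr /=.
  apply: eq_bigr => s _; rewrite big_split /= mulrCA; congr (_ * (_ * _)).
  by apply: eq_bigr => i _; rewrite mxE.
rewrite (bigID (fun f : {ffun 'I_n -> I} => injectiveb f)) /= addrC big1 ?add0r.
  rewrite (partition_big (fun f : {ffun _ -> _} => [set f i | i in 'I_n])
                         (fun S => #|S| == n)) /=.
    apply: eq_bigr => S /eqP Sn.
    pose h (s : 'S_n) := [ffun i => elt S (s i)].
    have h_inj : injective h.
      move=> s1 s2 e; apply/perm.permP => i; apply: (elt_inj Sn).
      by have := congr1 (fun f : {ffun _ -> _} => f i) e; rewrite !ffunE.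
    transitivity (\sum_(f in h @: [set: 'S_n])
        (\prod_i P (f i) i) * \det (\matrix_(i, j) Q (f i) j)).
      apply: eq_bigl => f; apply/andP/imsetP => [[/injectiveP fi /eqP fS]|[s _ ->]].
        have fx i : exists j, elt S j == f i.
          have : f i \in codom (elt S).
            by rewrite codom_elt // -fS; apply/imsetP; exists i.
          by case/codomP=> j ->; exists j.
        have si : injective (fun i => xchoose (fx i)).
          move=> i j e; apply: fi.
          by rewrite -(eqP (xchooseP (fx i))) e (eqP (xchooseP (fx j))).
        exists (perm si); rewrite ?inE //; apply/ffunP => i.
        by rewrite ffunE permE (eqP (xchooseP (fx i))).
      split; first by apply/injectiveP => i j; rewrite !ffunE => /(elt_inj Sn)/perm_inj.
      apply/eqP/setP => k; rewrite -(codom_elt _ Sn).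
      apply/imsetP/codomP => [[i _ ->]|[j ->]].
        by exists (s i); rewrite ffunE.
      by exists ((s^-1)%g j); rewrite // ffunE permKV.
    rewrite big_imset /=; last by move=> ? ? _ _; exact: h_inj.
    (* The permutations act on the row index of the [P] minor, so its determinant appears in
       transposed form. *)
    rewrite -[X in _ = X * _]det_tr [X in _ = X * _]/determinant big_distrl /=.
    rewrite big_mkcond /=; apply: eq_bigr => s _; rewrite inE.
    have -> : \matrix_(i, j) Q (h s i) j = row_perm s (\matrix_(i, j) Q (elt S i) j).
      by apply/matrixP => i j; rewrite !mxE ffunE.
    rewrite row_permE det_mulmx det_perm [LHS]mulrA [X in X * _ = _]mulrC.
    by congr (_ * _ * _); apply: eq_bigr => i _; rewrite !mxE ffunE.
  by move=> f /injectiveP fi; rewrite card_imset // card_ord.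
move=> f /injectivePn[i [j ij fij]].
rewrite (determinant_alternate (i1 := i) (i2 := j)) ?mulr0 // => k.
by rewrite !mxE fij.
Qed.

End CauchyBinet.

(** * Determinants of rooted subgraphs *)

Definition upd (I : eqType) (K : Type) (g : I -> K) (i : I) (k : K) : I -> K :=
  fun j => if j == i then k else g j.

Lemma upd_inj (I K : eqType) (g : I -> K) i k :
  injective g -> (forall j, j != i -> g j != k) -> injective (upd g i k).
Proof.
move=> gi gk j j'; rewrite /upd.
case: (eqVneq j i) => [->|ji]; case: (eqVneq j' i) => [->|j'i] //.
- by move=> e; case/eqP: (gk j' j'i).
- by move=> e; case/eqP: (gk j ji).
- exact: gi.
Qed.

Lemma upd_codom (I : finType) (K : eqType) (g : I -> K) i k k' :
  injective g ->
  (k' \in codom (upd g i k)) = (k' == k) || (k' \in codom g) && (k' != g i).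
Proof.
move=> gi; apply/codomP/orP => [[j ->]|[/eqP->|/andP[/codomP[j ->] nj]]].
- rewrite /upd; case: (eqVneq j i) => [_|ji]; [by left|right].
  by rewrite codom_f (inj_eq gi).
- by exists i; rewrite /upd eqxx.
- by exists j; rewrite /upd; case: (eqVneq j i) nj => [->|//]; rewrite eqxx.
Qed.

Section Incidence.

Variables (X A : finType) (o t : A -> X) (inv : A -> A).
Hypothesis symG : symmetric_digraph o t inv.
Variable R : comNzRingType.

Local Notation edge := (edge inv).
Local Notation N := #|X|.
Local Notation index := ({set A} + X)%type.
Local Notation out := (out o inv).
Local Notation component := (component o t inv).
Local Notation cycs := (cycs o t inv).
Local Notation good := (good o t inv).
Local Notation iscycle := (iscycle o t inv).

Definition arcvec (s : R) (a : A) (x : X) : R := (t a == x)%:R + s * (o a == x)%:R.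

(** For an edge and [s ^+ 2 = 1], picking the other arc multiplies the vector by [s]; edge vectors
    occur in pairs, where this factor cancels. *)
Definition edgevec (s : R) (e : {set A}) (x : X) : R :=
  if [pick a in e] is Some a then arcvec s a x else 0.

Definition vec (s : R) (k : index) : X -> R :=
  match k with inl e => edgevec s e | inr v => fun x => (v == x)%:R end.

Definition incmx (s : R) (g : 'I_N -> index) : 'M[R]_N :=
  \matrix_(i, j) vec s (g i) (enum_val j).

(** This is the determinant of [M] with row [i] replaced by [y], written as a Laplace expansion to
    make linearity in [y] immediate. *)
Definition rowdet (M : 'M[R]_N) i (y : X -> R) : R :=
  \sum_j y (enum_val j) * cofactor M i j.

Lemma rowdet_lin M i (y u v : X -> R) a b : (forall x, y x = a * u x + b * v x) ->
  rowdet M i y = a * rowdet M i u + b * rowdet M i v.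
Proof.
move=> yE; rewrite /rowdet !big_distrr -big_split /=; apply: eq_bigr => j _.
by rewrite yE mulrDl !mulrA.
Qed.

Lemma rowdet_row s g i j :
  rowdet (incmx s g) i (vec s (g j)) = if j == i then \det (incmx s g) else 0.
Proof.
have := congr1 (fun M : 'M_N => M j i) (mul_mx_adj (incmx s g)).
rewrite !mxE -mulrb => <-; apply: eq_bigr => k _; by rewrite !mxE.
Qed.

Lemma rowdet_upd s g i k :
  rowdet (incmx s g) i (vec s k) = \det (incmx s (upd g i k)).
Proof.
rewrite (expand_det_row _ i); apply: eq_bigr => j _; rewrite mxE /upd eqxx.
congr (_ * (_ * \det _)); apply/matrixP => p q; rewrite !mxE.
by rewrite eq_sym (negPf (neq_lift _ _)).
Qed.

Lemma edgevec_arc s a : s ^+ 2 = 1 -> exists2 eps : R, eps ^+ 2 = 1 &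
  forall x, edgevec s (edge a) x = eps * arcvec s a x.
Proof.
move=> s2; rewrite /edgevec; case: pickP => [b|/(_ a)]; last by rewrite set21.
case/set2P=> ->; first by exists 1; rewrite ?expr1n // => x; rewrite mul1r.
exists s => // x; rewrite /arcvec (o_inv symG) (t_inv symG) mulrDr mulrA -expr2 s2 mul1r.
exact: addrC.
Qed.

Lemma edgevec0 s a x : o a != x -> t a != x -> edgevec s (edge a) x = 0.
Proof.
move=> oa ta; rewrite /edgevec; case: pickP => [b|//].
case/set2P=> ->; rewrite /arcvec ?(o_inv symG) ?(t_inv symG);
by rewrite (negPf oa) (negPf ta) mulr0 addr0.
Qed.

Lemma rowdet_arc s g i a : s ^+ 2 = 1 ->
  exists2 eps : R, eps ^+ 2 = 1 &
  rowdet (incmx s g) i (vec s (inl (edge a))) =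
  eps * (rowdet (incmx s g) i (vec s (inr (t a)))
         + s * rowdet (incmx s g) i (vec s (inr (o a)))).
Proof.
move=> s2; have [eps e2 eE] := edgevec_arc a s2; exists eps => //.
rewrite mulrDr mulrA; apply: rowdet_lin => x /=.
by rewrite eE mulrDr mulrA.
Qed.

(* Every row other than [i] is orthogonal to the cofactors of row [i], so these
   cofactors are transported by [- s] along the corresponding edges. *)
Lemma rowdet_step s g i j a : s ^+ 2 = 1 -> g j = inl (edge a) -> j != i ->
  rowdet (incmx s g) i (vec s (inr (t a))) =
  - s * rowdet (incmx s g) i (vec s (inr (o a))).
Proof.
move=> s2 gj ji; have [eps e2 eE] := rowdet_arc g i a s2.
have := rowdet_row s g i j; rewrite (negPf ji) gj eE => /(congr1 (fun u => eps * u)).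
by rewrite mulr0 mulrA -expr2 e2 mul1r mulNr => /eqP; rewrite addr_eq0 => /eqP.
Qed.

Lemma rowdet_path s g i a p : s ^+ 2 = 1 ->
  path (fun a b => t a == o b) a p ->
  (forall b, b \in p -> exists2 j, g j = inl (edge b) & j != i) ->
  rowdet (incmx s g) i (vec s (inr (t (last a p)))) =
  (- s) ^+ size p * rowdet (incmx s g) i (vec s (inr (t a))).
Proof.
move=> s2; elim: p a => [|b p IHp] a /=; first by rewrite mul1r.
case/andP=> /eqP ab pp pg; rewrite (IHp b) // => [|c pc]; last first.
  by apply: pg; rewrite inE pc orbT.
have [j gj ji] := pg b (mem_head _ _); rewrite (rowdet_step s2 gj ji) ab.
by rewrite mulrA -exprSr.
Qed.

Lemma det_col0 s g x : (forall j, vec s (g j) x = 0) -> \det (incmx s g) = 0.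
Proof.
move=> g0; rewrite (expand_det_col _ (enum_rank x)) big1 // => j _.
by rewrite mxE enum_rankK g0 mul0r.
Qed.

Definition edge_sign (J : bool) : R := if J then -1 else 1.

Lemma edge_sign2 J : edge_sign J ^+ 2 = 1.
Proof. by case: J; rewrite /edge_sign ?sqrrN expr1n. Qed.

(** The rows are distinct unit vectors, so the matrix is orthogonal. *)
Lemma det_roots s g : injective g -> (forall i, exists x, g i = inr x) ->
  \det (incmx s g) ^+ 2 = 1.
Proof.
move=> gi gr; rewrite expr2 -{2}det_tr -det_mulmx.
suff -> : incmx s g *m (incmx s g)^T = 1%:M by rewrite det1.
apply/matrixP => i j; rewrite !mxE.
have [x gx] := gr i; have [y gy] := gr j.
rewrite (bigD1 (enum_rank x)) //= big1 ?addr0 => [|k kx].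
  rewrite !mxE gx gy /= enum_rankK eqxx mul1r -(inj_eq gi) gx gy.
  by rewrite [in RHS]eq_sym.
rewrite !mxE gx /=; case: (x =P enum_val k) kx => [->|_]; last by rewrite mul0r.
by rewrite enum_valK eqxx.
Qed.

(** * Rows enumerating the edges and roots of a subgraph *)

Section Spec.

Variables (F : {set {set A}}) (T : {set X}) (g : 'I_N -> index).
Hypothesis gi : injective g.
Hypothesis gF : forall e, (inl e \in codom g) = (e \in F).
Hypothesis gT : forall x, (inr x \in codom g) = (x \in T).

Lemma card_index : (#|F| + #|T| = N)%N.
Proof.
have := card_codom gi; rewrite card_ord => <-.
have -> : #|codom g| = #|inl @: F :|: inr @: T|.
  apply: eq_card => -[e|x]; rewrite in_setU.
    rewrite gF mem_imset; last by move=> ? ? [].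
    by rewrite orbC; case: imsetP => // -[].
  rewrite gT orbC mem_imset; last by move=> ? ? [].
  by rewrite orbC; case: imsetP => // -[].
rewrite cardsU !card_imset; try by move=> ? ? [].
suff -> : inl @: F :&: inr @: T = set0 :> {set index} by rewrite cards0 subn0.
apply/setP => k; rewrite in_setI in_set0; apply/negP => /andP[/imsetP[e _ ->]].
by case/imsetP.
Qed.

Lemma index_edge e : e \in F -> exists i, g i = inl e.
Proof. by rewrite -gF => /codomP[i ->]; exists i. Qed.

Lemma spec_upd i e v : g i = inl e -> v \notin T ->
  [/\ injective (upd g i (inr v)),
      forall e', (inl e' \in codom (upd g i (inr v))) = (e' \in F :\ e)
    & forall x, (inr x \in codom (upd g i (inr v))) = (x \in v |: T)].
Proof.
move=> gie vT; split.
- apply: upd_inj => // j _; apply: contraNneq vT => gj; rewrite -gT.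
  by apply/codomP; exists j.
- by move=> e'; rewrite upd_codom // gF gie in_setD1 /= andbC.
- by move=> x; rewrite upd_codom // gT gie in_setU1 /= andbT.
Qed.

End Spec.

Implicit Types (F : {set {set A}}) (T : {set X}).

(* Since the degrees sum to 2 #|F|, the numbers #|out F x| + 2 [x in T], all at
   least 2, sum to 2 N. *)
Lemma degree2 F T : F \subset Eset inv -> (#|F| + #|T| = N)%N ->
  (forall x, x \notin T -> (1 < #|out F x|)%N) ->
  forall x, #|out F x| = if x \in T then 0%N else 2.
Proof.
move=> sFE cFT out2.
have ge2 x : (2 <= #|out F x| + 2 * (x \in T))%N.
  by case: (boolP (x \in T)) => [_|/out2]; lia.
have := leqif_sum (fun x (_ : xpredT x) => leqif_eq (ge2 x)).
have -> : (\sum_x (#|out F x| + 2 * (x \in T)) = \sum_(x : X) 2)%N.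
  rewrite big_split /= (sum_out symG sFE) -big_distrr /= sum_nat_const.
  have -> : (\sum_x (x \in T) = #|T|)%N.
    by rewrite -sum1_card [RHS]big_mkcond; apply: eq_bigr => x _; case: (_ \in _).
  by rewrite -mulnDr cFT mulnC.
move=> [_ /esym]; rewrite eqxx => /forallP e2 x.
by have /eqP := e2 x; case: (x \in T); lia.
Qed.

Lemma det_good J F T g :
  F \subset Eset inv -> injective g ->
  (forall e, (inl e \in codom g) = (e \in F)) ->
  (forall x, (inr x \in codom g) = (x \in T)) ->
  \det (incmx (edge_sign J) g) ^+ 2 =
    if good J F T then 4%:R ^+ #|cycs F setT| else 0.
Proof.
have [n] := ubnP #|F|; elim: n F T g => // n IHn F T g leFn sFE gi gF gT.
have s2 := edge_sign2 J; pose s := edge_sign J; rewrite -/s in s2 *.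
have cardF' a : edge a \in F -> (#|F :\ edge a| < n)%N.
  by move=> Fa; move: leFn; rewrite (cardsD1 (edge a)) Fa.
have sF'E a : F :\ edge a \subset Eset inv := subset_trans (subsetDl _ _) sFE.
have vec0 v j : v \notin T -> (forall a, g j = inl (edge a) -> o a != v /\ t a != v) ->
    vec s (g j) v = 0.
  move=> vT ga; case gj: (g j) => [e|x] /=.
    have : e \in F by rewrite -gF -gj codom_f.
    move=> /(subsetP sFE)/imsetP[a _ ea]; rewrite ea in gj *.
    by have [] := ga a gj; apply: edgevec0.
  by case: eqP vT => // <-; rewrite -gT -gj codom_f.
have out_F a j : g j = inl (edge a) -> edge a \in F.
  by move=> gj; rewrite -gF -gj codom_f.
have [/existsP[v /andP[vT dv]]|no_leaf] :=
    boolP [exists v, (v \notin T) && (#|out F v| < 2)%N].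
  have [/eqP/cards1P[a leaf_v]|d0] := eqVneq #|out F v| 1%N; last first.
    (* An isolated vertex that is not a root gives a zero column, and its component has neither root
       nor cycle. *)
    have out0 : out F v = set0 by apply/eqP; rewrite -cards_eq0; lia.
    have F0 a : edge a \in F -> o a != v.
      by move=> Fa; apply/eqP => oa; have := in_set0 a; rewrite -out0 in_out Fa oa eqxx.
    rewrite (@det_col0 _ _ v) => [|j]; last first.
      apply: vec0 => // a /out_F Fa; split; first exact: F0.
      by rewrite -(o_inv symG) F0 // (edge_inv symG).
    rewrite expr0n /=; case: ifP => // /goodP/(_ v).
    rewrite /cond (comp_out0 symG out0); case/orP=> [/andP[/cards1P[y] Tv _]|].
      have : y \in T :&: [set v] by rewrite Tv set11.
      by rewrite in_setI in_set1 andbC => /andP[/eqP ->]; rewrite (negPf vT).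
    case/and4P=> _ _ /cards1P[C eC] _.
    have : C \in cycs F [set v] by rewrite eC set11.
    case/cycsP=> c [cc cv _]; have [a ca] := iscycle_ex cc.
    by have := F0 a (iscycle_arc cc ca); have /set1P -> := cv a ca; rewrite eqxx.
  have [Fa oa] := leaf_arc leaf_v; have [i gia] := index_edge gF Fa.
  have [ui uF uT] := spec_upd gi gF gT gia vT.
  rewrite (good_leaf symG _ leaf_v vT) -(cycsT_leaf symG leaf_v).
  rewrite -(IHn _ _ _ (cardF' a Fa) (sF'E a) ui uF uT).
  have := rowdet_row s g i i; rewrite eqxx => <-.
  (* Expanding the row of [a] places a root at either end. With the root at [t a], column [v] is
     zero; the other term belongs to the cut subgraph. *)
  have [eps e2] := rowdet_arc g i a s2; rewrite gia => ->.
  rewrite oa !rowdet_upd [X in X + _](@det_col0 _ _ v) => [|j].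
    by rewrite add0r !exprMn e2 s2 !mul1r.
  have ta_v : t a != v by rewrite -oa eq_sym (o_neq_t symG).
  rewrite /upd; case: (eqVneq j i) => [_|ji]; first by rewrite /= (negPf ta_v).
  apply: vec0 => // b gjb; have Fb := out_F _ _ gjb.
  have nab : edge b != edge a.
    by apply: contraNneq ji => eab; rewrite -(inj_eq gi) gjb gia eab.
  split; apply: contraNneq nab => ob; first by rewrite (leaf_eq leaf_v Fb ob).
  by rewrite -(leaf_eq leaf_v (a := inv b)) ?(edge_inv symG) ?(o_inv symG).
(* Now roots are isolated and all other vertices have degree 2. *)
have deg := degree2 sFE (card_index gi gF gT).
have {deg} deg x : #|out F x| = if x \in T then 0%N else 2.
  apply: deg => {}x xT; rewrite ltnNge; apply: contra no_leaf => dx.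
  by apply/existsP; exists x; rewrite xT ltnS.
have [F0|[e Fe]] := set_0Vmem F.
  have T1 : T = setT.
    apply/setP => x; rewrite in_setT; have := deg x; case: ifP => // _.
    by rewrite F0 out_set0 cards0.
  rewrite F0 cycs_set0 cards0 expr0; have -> : good J set0 T.
    apply/goodP => x.
    by rewrite /cond cycs_set0 eqxx andbT T1 setTI comp_out0 ?cards1 ?out_set0.
  apply: det_roots => // i; case gie: (g i) => [e|x]; last by exists x.
  by have := gF e; rewrite F0 inE -gie codom_f.
have /imsetP[a0 _ ea0] := subsetP sFE _ Fe; rewrite ea0 in Fe.
have notT a : edge a \in F -> o a \notin T.
  move=> Fa; apply/negP => oT; have := deg (o a); rewrite oT => /eqP.
  by rewrite cards_eq0 => /eqP o0; have := in_set0 a; rewrite -o0 in_out Fa eqxx.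
have [c cc] : exists c, iscycle F c.
  apply: (exists_cycle symG Fe) => a Fa; apply: next_arc => //.
  by rewrite deg -(o_inv symG) (negPf (notT _ _)) // (edge_inv symG).
case: c cc => [|a p] cc; first by case/and5P: cc.
have ca : a \in a :: p := mem_head _ _.
have Fa := iscycle_arc cc ca; have [i gia] := index_edge gF Fa.
have aT := notT a Fa; have [ui uF uT] := spec_upd gi gF gT gia aT.
have /and5P[_ _ cyc_p /= /andP[nap _] _] := cc.
move: cyc_p; rewrite /= rcons_path => /andP[pp /eqP lastp].
(* The row of [a] gives the cofactor sum at [t a] plus [s] times the one at [o a]; transport along
   the rest [p] of the cycle relates the two by [(- s) ^+ size p]. *)
have detE : exists2 eps : R, eps ^+ 2 = 1 &
    \det (incmx s g) = eps * ((- s) ^+ size p + s) * \det (incmx s (upd g i (inr (o a)))).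
  have := rowdet_path (i := i) s2 pp; rewrite lastp => /(_ g) pathE.
  have {pathE} := pathE _; rewrite !rowdet_upd => pathE.
  have [eps e2 eE] := rowdet_arc g i a s2; exists eps => //.
  have := rowdet_row s g i i; rewrite eqxx gia => <-.
  rewrite eE !rowdet_upd -mulrA mulrDl pathE => [|b pb].
    rewrite [X in _ = _ * (X + _)]mulrA -expr2 -exprM mulnC exprM sqrrN s2.
    by rewrite expr1n mul1r.
  have Fb : edge b \in F by apply: (iscycle_arc cc); rewrite inE pb orbT.
  have [j gjb] := index_edge gF Fb; exists j => //.
  apply: contraNneq nap => ji; apply/mapP; exists b => //.
  by move: gjb; rewrite ji gia => -[].
have [eps e2 ->] := detE.
(* As [p] omits [a], the cycle is odd when [size p] is even. The factor is 2 up to sign for an odd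
   cycle with [J = false], and 0 otherwise. *)
have [/andP[nJ op]|/negP notodd] := boolP (~~ J && ~~ odd (size p)); last first.
  have -> : (- s) ^+ size p + s = 0.
    rewrite /s /edge_sign; case: (J) notodd => /= [_|/negP/negPn op].
      by rewrite opprK expr1n subrr.
    by rewrite -signr_odd op expr1 addNr.
  rewrite mulr0 mul0r expr0n /=; case: ifP => // gd.
  by have [nJ _ _ /= op] := good_cycle symG cc ca gd; rewrite nJ op in notodd.
have -> : good J F T = good J (F :\ edge a) (o a |: T).
  apply/idP/idP; first exact: (good_break symG cc ca).
  by apply: (good_unbreak symG cc ca) => // x; rewrite deg; case: ifP.
have -> : (- s) ^+ size p + s = 2%:R.
  by rewrite /s /edge_sign (negPf nJ) -signr_odd (negPf op) expr0.
have e4 : 2%:R ^+ 2 = 4%:R :> R by rewrite -natrX.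
rewrite !exprMn e2 mul1r e4 (IHn _ _ _ (cardF' a Fa) (sF'E a) ui uF uT).
case: ifP => [gd|_]; last by rewrite mulr0.
have gdF : good J F T.
  by apply: (good_unbreak symG cc ca) gd => // x; rewrite deg; case: ifP.
by rewrite (cycsT_break symG cc ca gdF) exprS.
Qed.

End Incidence.

(** * Expansion over subgraphs *)

Section Expansion.

Variables (X A : finType) (o t : A -> X) (inv : A -> A).
Hypothesis symG : symmetric_digraph o t inv.
Variable R : idomainType.

Local Notation N := #|X|.
Local Notation index := ({set A} + X)%type.
Local Notation component := (component o t inv).
Local Notation cycs := (cycs o t inv).
Local Notation good := (good o t inv).
Local Notation vec := (@vec X A o t R).
Local Notation edgevec := (@edgevec X A o t R).
Local Notation incmx := (@incmx X A o t R).
Local Notation sgn := (edge_sign R).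

Implicit Types (F : {set {set A}}) (S T D : {set X}).

Lemma cycs_goodL F T : good true F T -> cycs F setT = set0.
Proof.
move=> gd; apply/eqP; rewrite -subset0; apply/subsetP => C /cycsP[c [cc _ _]].
by have [a ca] := iscycle_ex cc; have [] := good_cycle symG cc ca gd.
Qed.

Lemma eq_incmx s g g' : g =1 g' -> incmx s g = incmx s g'.
Proof. by move=> gg'; apply/matrixP => i j; rewrite !mxE gg'. Qed.

(** A path without repeated vertices has fewer than [N] steps, so the search in [distH] succeeds
    within its range. *)
Lemma walkn_connect F S l m : connect (adjH o t inv (F, S)) l m ->
  walkn o t inv (F, S) (distH o t inv (F, S) l m) l m.
Proof.
move=> /connectP[p0 p0P -> {m}].
case: (shortenP p0P) => p pP up _; move lastp: (last l p) => m.
have szp : (size p < N)%N.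
  by have := max_card (mem (l :: p)); rewrite (card_uniqP up).
have wp : walkn o t inv (F, S) (size p) l m.
  rewrite -lastp; elim: p (l) pP {up lastp szp} => [|x p IHp] y /=; first by rewrite eqxx.
  case/andP=> /existsP[a /and3P[Fa oa /eqP ta]] pP; apply/existsP; exists a.
  by rewrite Fa oa ta IHp.
have has_w : has (fun n => walkn o t inv (F, S) n l m) (iota 0 N.+1).
  by apply/hasP; exists (size p); rewrite // mem_iota add0n ltnS (ltnW szp).
have := nth_find 0%N has_w; rewrite nth_iota ?add0n //.
by rewrite -[X in (_ < X)%N](size_iota 0) -has_find.
Qed.

Lemma rowdet_walkn s g i F S n l m : s ^+ 2 = 1 ->
  (forall e, e \in F -> exists2 j, g j = inl e & j != i) ->
  walkn o t inv (F, S) n l m ->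
  rowdet (incmx s g) i (vec s (inr m)) =
  (- s) ^+ n * rowdet (incmx s g) i (vec s (inr l)).
Proof.
move=> s2 gF; elim: n l => [|n IHn] l /=; first by move/eqP->; rewrite mul1r.
case/existsP=> a /and3P[Fa /eqP oa /IHn->]; have [j gj ji] := gF _ Fa.
by rewrite (rowdet_step symG s2 gj ji) oa mulrA -exprSr.
Qed.

(** Transporting the cofactors of row [i] along a shortest walk makes the determinant rooted at [m]
    equal to [(- s)] to the distance times the one rooted at [l]; the product is then this sign
    times a square known from [det_good]. *)
Lemma det_good2 J F T g i l m (S : {set X}) :
  F \subset Eset inv -> injective g ->
  (forall e, (inl e \in codom g) = (e \in F)) ->
  (forall x, (inr x \in codom g) = (x \in m |: T)) ->
  g i = inr m -> m \notin T ->
  \det (incmx (sgn J) g) * \det (incmx (sgn J) (upd g i (inr l))) =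
    if [&& l \notin T, good J F (l |: T) & good J F (m |: T)]
    then 4%:R ^+ #|cycs F setT| * (- sgn J) ^+ distH o t inv (F, S) l m
    else 0.
Proof.
move=> sFE gi gF gT gim mT; set s := sgn J.
have s2 : s ^+ 2 = 1 := edge_sign2 R J.
have updm : \det (incmx s (upd g i (inr m))) = \det (incmx s g).
  congr (\det _); apply: eq_incmx => j; rewrite /upd; case: eqVneq => // ->.
  by rewrite gim.
have [lT|lT] := boolP (l \in T).
  have : inr l \in codom g by rewrite gT in_setU1 lT orbT.
  case/codomP=> j gj; have ji : j != i.
    apply: contraNneq mT => ji; move: gj; rewrite ji gim => -[<-] //.
  have := rowdet_row o t s g i j; rewrite (negPf ji) -gj rowdet_upd => ->.
  by rewrite mulr0.
have ui : injective (upd g i (inr l)).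
  apply: upd_inj => // j ji; apply/eqP => gj.
  have : inr l \in codom g by rewrite -gj codom_f.
  rewrite gT in_setU1 (negPf lT) orbF => /eqP lm.
  by move/eqP: ji; apply; apply: gi; rewrite gj gim lm.
have uF e : (inl e \in codom (upd g i (inr l))) = (e \in F).
  by rewrite upd_codom // gF gim /= andbT.
have uT x : (inr x \in codom (upd g i (inr l))) = (x \in l |: T).
  rewrite upd_codom // gT gim !in_setU1 -[inr x == inr l]/(x == l).
  rewrite -[inr x == inr m]/(x == m); congr (_ || _).
  by case: eqVneq => [->|_]; rewrite ?andbT //= (negPf mT).
have Dl := det_good symG R J sFE ui uF uT; have Dm := det_good symG R J sFE gi gF gT.
rewrite -/s in Dl Dm.
have [gl|gl] := boolP (good J F (l |: T)); rewrite ?(negPf gl) /= in Dl *; last first.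
  by move/eqP: Dl; rewrite sqrf_eq0 => /eqP ->; rewrite mulr0.
have [gm|gm] := boolP (good J F (m |: T)); rewrite ?(negPf gm) /= in Dm *; last first.
  by move/eqP: Dm; rewrite sqrf_eq0 => /eqP ->; rewrite mul0r.
(* With [l] as root, its component has no other root and no cycle; with [m] instead, it still needs
   a root, which can only be [m]. *)
have lm : connect (adjH o t inv (F, S)) l m.
  have [TW cW] := good_root gl (setU11 _ _).
  have := goodP _ _ _ _ _ _ gm l; rewrite /cond cW cards0 !andbF orbF eqxx andbT.
  case/cards1P=> y Ty; have : y \in (m |: T) :&: component F l by rewrite Ty set11.
  rewrite in_setI in_setU1 => /andP[/orP[/eqP ->|yT yW]]; first by rewrite inE.
  have : y \in (l |: T) :&: component F l by rewrite in_setI in_setU1 yT orbT.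
  by rewrite TW => /set1P eyl; rewrite -eyl yT in lT.
have gFi e : e \in F -> exists2 j, g j = inl e & j != i.
  move=> Fe; have [j gj] := index_edge gF Fe; exists j => //.
  by apply/eqP => ji; rewrite ji gim in gj.
have := rowdet_walkn s2 gFi (walkn_connect lm).
rewrite !rowdet_upd updm => ->.
by rewrite -mulrA -expr2 Dl gl mulrC.
Qed.

(** * Factoring the network matrix *)

Section Matrix.

Variables (s : R) (ce : {set A} -> R) (cl : X -> R) (D : {set X}) (p : X -> X).
Hypothesis pD : forall x, x \notin D -> p x = x.

(** The index type contains all sets of arcs, and those that are not edges get coefficient 0. Roots
    in [D] stand for prescribed rows, hence the 1. *)
Definition coef (k : index) : R :=
  match k with
  | inl e => (e \in Eset inv)%:R * ce e
  | inr v => if v \in D then 1 else cl v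
  end.

Definition weightedvec (k : index) (x : X) : R :=
  coef k * (if k is inl _ then (if x \in D then 0 else vec s k x) else vec s k x).

Definition mapidx (k : index) : index := if k is inr v then inr (p v) else k.

(* For [p = id] the rows in [D] are those of the identity matrix; relocating the
   root of a row of [D] with [p] produces cofactors. *)
Definition network (x y : X) : R :=
  if x \in D then (p x == y)%:R
  else \sum_(e in Eset inv) ce e * edgevec s e x * edgevec s e y + (x == y)%:R * cl x.

Lemma networkE x y :
  network x y = \sum_k weightedvec k x * vec s (mapidx k) y.
Proof.
rewrite big_sumType /= /network /weightedvec /=.
rewrite [X in _ = _ + X](bigD1 x) //= eqxx [X in _ = _ + (_ + X)]big1 => [|v vx]; last first.
  by rewrite (negPf vx) mulr0 mul0r.
case: (boolP (x \in D)) => [xD|xD].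
  by rewrite big1 ?add0r ?addr0 ?mul1r // => e _; rewrite mulr0 mul0r.
rewrite addr0 mulr1 pD // [_ * cl x]mulrC; congr (_ + _).
rewrite big_mkcond /=; apply: eq_bigr => e _.
by case: (e \in _); rewrite ?mul1r // !mul0r.
Qed.

(** The two matrices differ, up to row factors, by the edge entries erased in columns of [D]. A
    permutation with a nonzero term sends each root of [D] to its own column, so edge rows never
    meet these columns. *)
Lemma det_weightedvec F T g : injective g ->
  (forall e, (inl e \in codom g) = (e \in F)) ->
  (forall x, (inr x \in codom g) = (x \in T)) -> D \subset T ->
  \det (\matrix_(i, j) weightedvec (g i) (enum_val j)) =
  (\prod_i coef (g i)) * \det (incmx s g).
Proof.
move=> gi gF gT DT; rewrite /determinant big_distrr /=; apply: eq_bigr => q _.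
rewrite mulrCA; congr (_ * _); rewrite -big_split /=.
pose fixes i := if g i is inr v then (v \in D) ==> (enum_val (q i) == v) else true.
have [/forallP qD|] := boolP [forall i, fixes i].
  apply: eq_bigr => i _; rewrite !mxE /weightedvec; congr (_ * _).
  case gie: (g i) => [e|//]; case: ifP => // qiD.
  have : inr (enum_val (q i)) \in codom g by rewrite gT (subsetP DT).
  case/codomP=> j gj; have := qD j.
  rewrite /fixes -gj qiD /= => /eqP/enum_val_inj/perm_inj ji.
  by move: gj; rewrite ji gie.
case/forallPn=> i; rewrite /fixes; case gie: (g i) => [//|v].
rewrite negb_imply => /andP[vD nv].
rewrite (bigD1 i) // [RHS](bigD1 i) //= !mxE /weightedvec gie /=.
by rewrite [v == _]eq_sym (negPf nv) !mulr0 !mul0r.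
Qed.

Definition idxset (H : subgraph X A) : {set index} :=
  [set k | match k with inl e => e \in H.1 | inr x => x \in H.2 :|: D end].

Lemma idxset_inl H e : (inl e \in idxset H) = (e \in H.1).
Proof. by rewrite inE. Qed.

Lemma idxset_inr H x : (inr x \in idxset H) = (x \in H.2 :|: D).
Proof. by rewrite inE. Qed.

Lemma card_idxset H : #|idxset H| = (#|H.1| + #|H.2 :|: D|)%N.
Proof.
rewrite -!sum1_card big_sumType /=.
by congr (_ + _)%N; apply: eq_bigl => ?; rewrite ?idxset_inl ?idxset_inr.
Qed.

Lemma prod_coef H : spanning inv D H ->
  \prod_(k in idxset H) coef k = (\prod_(e in H.1) ce e) * \prod_(u in H.2) cl u.
Proof.
case/andP=> HE HD; rewrite big_sumType /=; congr (_ * _).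
  under eq_bigl => e do rewrite idxset_inl.
  by apply: eq_bigr => e He; rewrite (subsetP HE) // mul1r.
under eq_bigl => x do rewrite idxset_inr in_setU.
rewrite (bigID (mem H.2)) /= [X in _ * X]big1 ?mulr1 => [|x].
  apply: eq_big => x; first by case: (x \in H.2); rewrite ?andbT ?andbF.
  by case/andP=> _ /(subsetP HD); rewrite in_setC => /negPf ->.
by case/andP=> /orP[->//|->].
Qed.

Local Notation elt := (@elt _ N (inl set0 : index)).

Lemma det_network :
  \det (\matrix_(i < N, j < N) network (enum_val i) (enum_val j)) =
  \sum_(H : subgraph X A | spanning inv D H && (#|idxset H| == N))
    ((\prod_(e in H.1) ce e) * \prod_(u in H.2) cl u) *
    (\det (incmx s (elt (idxset H))) * \det (incmx s (mapidx \o elt (idxset H)))).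
Proof.
have -> : \matrix_(i < N, j < N) network (enum_val i) (enum_val j) =
   \matrix_(i, j) \sum_k weightedvec k (enum_val i) * vec s (mapidx k) (enum_val j).
  by apply/matrixP => i j; rewrite !mxE networkE.
rewrite (cauchy_binet (inl set0) (fun k i => weightedvec k (enum_val i))
           (fun k i => vec s (mapidx k) (enum_val i))).
pose unidx (K : {set index}) : subgraph X A :=
  ([set e | inl e \in K], [set x | inr x \in K] :\: D).
pose ok (K : {set index}) :=
  (D \subset [set x | inr x \in K]) && ([set e | inl e \in K] \subset Eset inv).
(* An index set missing a root of [D] gives a zero column in the left factor, and one containing a
   non-edge gives a zero row. The others correspond to spanning subgraphs through [idxset]. *)
rewrite (bigID ok) /= addrC big1 ?add0r => [|K /andP[/eqP KN nok]]; last first.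
  suff -> : \det (\matrix_(i, j) weightedvec (elt K i) (enum_val j)) = 0 by rewrite mul0r.
  move: nok; rewrite negb_and => /orP[/subsetPn[d dD]|/subsetPn[e]]; rewrite inE => nK.
    rewrite (expand_det_col _ (enum_rank d)) big1 // => i _; rewrite mxE enum_rankK.
    rewrite /weightedvec; case ei: (elt K i) => [e|v]; rewrite ?dD ?mulr0 ?mul0r //=.
    have := codom_elt (inl set0) (inr v) KN; rewrite -ei codom_f => /esym.
    by rewrite ei; case: eqP => [->|_ _]; rewrite ?(negPf nK) ?mulr0 ?mul0r.
  move=> nE; have : inl e \in codom (elt K) by rewrite codom_elt.
  case/codomP=> i ei; rewrite (expand_det_row _ i) big1 // => j _.
  by rewrite mxE /weightedvec -ei /= (negPf nE) !mul0r.
rewrite (reindex_onto idxset unidx) /=; last first.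
  move=> K /andP[_ /andP[DK _]]; apply/setP => -[e|x]; first by rewrite idxset_inl inE.
  rewrite idxset_inr in_setU in_setD inE.
  case: (boolP (x \in D)) => [/(subsetP DK)|_]; last by rewrite orbF.
  by rewrite inE orbT => ->.
have spanE H : ok (idxset H) && (unidx (idxset H) == H) = spanning inv D H.
  have inlE : [set e | inl e \in idxset H] = H.1.
    by apply/setP => e; rewrite inE idxset_inl.
  have inrE : [set x | inr x \in idxset H] = H.2 :|: D.
    by apply/setP => x; rewrite inE idxset_inr.
  rewrite /ok /unidx inlE inrE subsetUr /= /spanning; congr (_ && _).
  case: H {inlE inrE} => F S; rewrite xpair_eqE eqxx /= setDUl setDv setU0 setDE.
  by apply/eqP/setIidPl.
apply: eq_big => [H|H]; first by rewrite -andbA spanE andbC.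
rewrite -andbA spanE => /andP[/eqP HN Hs].
rewrite (@det_weightedvec H.1 (H.2 :|: D)) ?subsetUr //; first last.
- by move=> x; rewrite codom_elt // idxset_inr.
- by move=> e; rewrite codom_elt // idxset_inl.
- exact: elt_inj.
by rewrite prod_elt // prod_coef // -[LHS]mulrA.
Qed.

End Matrix.

(** * Determinant and cofactors as sums over subgraphs *)

Section Sums.

Variables (J : bool) (ce : {set A} -> R) (cl : X -> R).
Local Notation s := (sgn J).
Local Notation weight H := ((\prod_(e in H.1) ce e) * \prod_(u in H.2) cl u).

Lemma det_network_id (D : {set X}) :
  \det (\matrix_(i < N, j < N) network s ce cl D id (enum_val i) (enum_val j)) =
  \sum_(H : subgraph X A | HJ o t inv D J H)
    (if J then 1 else 4%:R ^+ bH o t inv H) * weight H.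
Proof.
rewrite det_network //; symmetry; rewrite big_mkcond [RHS]big_mkcond /=.
apply: eq_bigr => H _; rewrite HJ_good.
case: (boolP (spanning inv D H)) => //= Hs; have /andP[HE _] := Hs.
(* By [good_card], a subgraph of the wrong size is absent from both sums. *)
have [/eqP HN|HN] := boolP (#|idxset D H| == N); last first.
  case: ifP => // /(good_card symG HE); rewrite -card_idxset => HN'.
  by rewrite HN' eqxx in HN.
have gi := elt_inj (k0 := inl set0) HN.
rewrite -[X in _ = _ * (_ * X)]/(\det (incmx s (mapidx id \o elt (inl set0) (idxset D H)))).
rewrite [in X in _ = _ * (_ * X)](@eq_incmx _ _ (elt (inl set0) (idxset D H))); last first.
  by move=> i /=; case: (elt _ _ i).
rewrite -expr2 (@det_good _ _ _ _ _ symG R J H.1 (H.2 :|: D)) //; last first.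
- by move=> x; rewrite codom_elt // idxset_inr.
- by move=> e; rewrite codom_elt // idxset_inl.
case: ifP => [gd|_]; last by rewrite mulr0.
rewrite [RHS]mulrC; congr (_ * _); case: (J) gd => gd.
  by rewrite (cycs_goodL gd) cards0.
by case: H {HE Hs HN gi} gd => F S gd; rewrite (bH_cycs symG S gd).
Qed.

(** Row [m] of this matrix is the unit vector at [l], so the determinant is a cofactor. In the
    Cauchy-Binet product the left factor has the root [m] where the right one has [l], as in
    [det_good2]. *)
Lemma det_network_swap (D : {set X}) l m : l \notin D -> m \notin D ->
  \det (\matrix_(i < N, j < N)
     network s ce cl (m |: D) (fun x => if x == m then l else x)
       (enum_val i) (enum_val j)) =
  \sum_(H : subgraph X A | HJlm o t inv D J l m H)
    (if J then 1 else 4%:R ^+ bH o t inv H * (-1) ^+ distH o t inv H l m) * weight H.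
Proof.
move=> lD mD; set p := fun x => _.
rewrite det_network; last by move=> x; rewrite /p in_setU1 negb_or => /andP[/negPf ->].
symmetry; rewrite big_mkcond [RHS]big_mkcond /=.
apply: eq_bigr => H _; rewrite HJlm_good //.
(* Since [m] has joined the boundary, it carries no self-loop. *)
have -> : spanning inv (m |: D) H = spanning inv D H && (m \notin H.2).
  rewrite /spanning -andbA; congr (_ && _);
  apply/subsetP/andP => [sH|[/subsetP sH mH] x xH].
    split; last by apply/negP => /sH; rewrite in_setC setU11.
    by apply/subsetP => x /sH; rewrite !in_setC in_setU1 negb_or => /andP[].
  rewrite in_setC in_setU1 negb_or -in_setC sH // andbT.
  by apply: contraNneq mH => <-.
case: (boolP (spanning inv D H)) => //= Hs; have /andP[HE _] := Hs.
have mT : (m \notin H.2 :|: D) = (m \notin H.2) by rewrite in_setU negb_or mD andbT.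
rewrite mT; have [mH|mH] /= := boolP (m \notin H.2); last by rewrite andbF.
have HDE : H.2 :|: (m |: D) = m |: (H.2 :|: D) by rewrite setUCA.
have [/eqP HN|HN] := boolP (#|idxset (m |: D) H| == N); last first.
  case: ifP => // /and3P[_ _ /(good_card symG HE)]; rewrite -HDE -card_idxset => HN'.
  by rewrite HN' eqxx in HN.
set K := idxset _ H in HN *; have gi := elt_inj (k0 := inl set0) HN.
have /codomP[i eim] : inr m \in codom (elt (inl set0) K : 'I_N -> index).
  by rewrite codom_elt // idxset_inr in_setU setU11 orbT.
rewrite [in X in _ = _ * (_ * X)](@eq_incmx _ _ (upd (elt (inl set0) K) i (inr l))); last first.
  move=> j; rewrite /upd /=; case: (eqVneq j i) => [->|ji].
    by rewrite -eim /= /p eqxx.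
  case ej: (elt _ _ j) => [//|x] /=; rewrite /p; case: eqVneq => // xm.
  by case/eqP: ji; apply: gi; rewrite ej xm eim.
rewrite (@det_good2 J H.1 (H.2 :|: D) _ i l m H.2) ?mT //; last first.
- by move=> x; rewrite codom_elt // idxset_inr HDE.
- by move=> e; rewrite codom_elt // idxset_inl.
case: ifP => [/and3P[_ _ gd]|_]; last by rewrite mulr0.
rewrite [RHS]mulrC; congr (_ * _); case: (J) gd => gd.
  by rewrite (cycs_goodL gd) cards0 /edge_sign opprK expr1n mulr1.
by case: H gd {HE Hs mT mH HDE HN K gi i eim} => F S gd; rewrite (bH_cycs symG S gd) /edge_sign.
Qed.

End Sums.

End Expansion.

(** * The Green function *)

Section BlockInverse.

Variables (X : finType) (K : fieldType) (f : X -> X -> K) (D : {set X}).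
Hypothesis fD : forall x y, x \in D -> f x y = (x == y)%:R.

Let full : 'M[K]_#|X| := \matrix_(i, j) f (enum_val i) (enum_val j).
Let block : 'M[K]_#|~: D| := \matrix_(i, j) f (enum_val i) (enum_val j).

Lemma sum_blocks (g : X -> K) :
  \sum_(i < #|X|) g (enum_val i) =
  \sum_(x in D) g x + \sum_(i < #|~: D|) g (enum_val i).
Proof.
rewrite -(big_enum_val g) /= (bigID (mem D)) /= -(big_enum_val g) /=.
by congr (_ + _); apply: eq_bigl => x; rewrite !inE.
Qed.

(** A kernel vector vanishes on [D] because of the identity rows, and its remaining part is then in
    the kernel of [block]. *)
Lemma block_unitmx : block \in unitmx -> full \in unitmx.
Proof.
move=> Bu; rewrite -unitmx_tr -row_free_unit; apply: inj_row_free => v vA0.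
pose vf x := v 0 (enum_rank x).
have vfE x : \sum_(k < #|X|) vf (enum_val k) * f x (enum_val k) = 0.
  have := congr1 (fun M : 'rV_ _ => M 0 (enum_rank x)) vA0; rewrite !mxE => e0.
  rewrite -[RHS]e0; by apply: eq_bigr => k _; rewrite !mxE enum_rankK /vf enum_valK.
have vD x : x \in D -> vf x = 0.
  move=> xD; rewrite -[RHS](vfE x) (bigD1 (enum_rank x)) //= big1 => [|k kx].
    by rewrite enum_rankK fD // eqxx mulr1 addr0.
  rewrite fD //; case: (x =P enum_val k) kx => [->|_]; last by rewrite mulr0.
  by rewrite enum_valK eqxx.
have c0 : \col_(i < #|~: D|) vf (enum_val i) = 0.
  rewrite -[LHS](mulKmx Bu).
  suff -> : block *m \col_i vf (enum_val i) = 0 by rewrite mulmx0.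
  apply/matrixP => i j; rewrite !mxE -[RHS](vfE (enum_val i)).
  rewrite (sum_blocks (fun y => vf y * f (enum_val i) y)) [X in _ = X + _]big1 ?add0r => [|x xD].
    by apply: eq_bigr => k _; rewrite !mxE mulrC.
  by rewrite vD // mul0r.
apply/rowP => k; rewrite mxE -[k]enum_valK; set x := enum_val k; rewrite -/(vf x).
have [/vD //|xD] := boolP (x \in D); rewrite -in_setC in xD.
have := congr1 (fun M : 'cV_ _ => M (enum_rank_in xD x) 0) c0.
by rewrite !mxE enum_rankK_in.
Qed.

(** The inverse of [full] also has identity rows on [D], so the terms through [D] disappear from the
    product of the two interior blocks. *)
Lemma block_invmx i j : block \in unitmx ->
  invmx block i j = invmx full (enum_rank (enum_val i)) (enum_rank (enum_val j)).
Proof.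
move=> Bu; have Fu := block_unitmx Bu.
pose B : 'M[K]_#|~: D| :=
  \matrix_(i, j) invmx full (enum_rank (enum_val i)) (enum_rank (enum_val j)).
have fullE x y : \sum_(k < #|X|) f x (enum_val k) *
    invmx full (enum_rank (enum_val k)) (enum_rank y) = (x == y)%:R.
  have := congr1 (fun M : 'M_ _ => M (enum_rank x) (enum_rank y)) (mulmxV Fu).
  rewrite !mxE (inj_eq enum_rank_inj) => e1.
  rewrite -[RHS]e1; by apply: eq_bigr => k _; rewrite !mxE enum_rankK enum_valK.
have invD x y : x \in D -> invmx full (enum_rank x) (enum_rank y) = (x == y)%:R.
  move=> xD; rewrite -(fullE x) (bigD1 (enum_rank x)) //= big1 => [|k kx].
    by rewrite enum_rankK fD // eqxx mul1r addr0.
  rewrite fD //; case: (x =P enum_val k) kx => [->|_]; last by rewrite mul0r.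
  by rewrite enum_valK eqxx.
suff -> : invmx block = B by rewrite mxE.
rewrite -[RHS](mulKmx Bu); suff -> : block *m B = 1%:M by rewrite mulmx1.
apply/matrixP => {}i {}j; rewrite !mxE -[i == j](inj_eq enum_val_inj) -fullE.
rewrite (sum_blocks (fun y => f (enum_val i) y * invmx full (enum_rank y) (enum_rank (enum_val j)))).
rewrite [X in _ = X + _]big1 ?add0r => [|x xD]; first by apply: eq_bigr => k _; rewrite !mxE.
rewrite invD //; case: eqP xD => [->|_ _]; last by rewrite mulr0.
by have := enum_valP j; rewrite inE => /negPf ->.
Qed.

End BlockInverse.

(** * Entries of the inverse as quotients *)

Section Green.

Variables (X A : finType) (o t : A -> X) (inv : A -> A).
Hypothesis symG : symmetric_digraph o t inv.
Variables (R : realType) (w : {set A} -> R[i]) (V : X -> R[i]) (z : R[i]).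
Variable dX : {set X}.

Local Notation K := R[i].
Local Notation edge := (edge inv).
Local Notation ce := (wJedge w).
Local Notation cl J := (wJloop t inv w V J z).
Local Notation s := (edge_sign K).

Lemma sum_edges (h : A -> K) (c : {set A} -> K) :
  \sum_(e in Eset inv) c e * (\sum_(a in e) h a) = \sum_a c (edge a) * h a.
Proof.
rewrite (partition_big edge (mem (Eset inv))) /=; last by move=> a _; apply/imsetP; exists a.
apply: eq_bigr => _ /imsetP[a0 _ ->]; rewrite big_distrr /=.
have in_edge a : (a \in edge a0) = (edge a == edge a0).
  by rewrite -[in LHS](edge_fiber symG a0) inE.
by apply: eq_big => // a; rewrite in_edge => /eqP ->.
Qed.

(** The rank-one matrix of an edge is split over its two arcs, each giving a diagonal entry at its
    head and an entry [r] between its ends, to match the arc sums in [piw] and [MV]. *)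
Lemma edgevecM (r : K) a x y : r ^+ 2 = 1 ->
  edgevec o t r (edge a) x * edgevec o t r (edge a) y =
  \sum_(b in edge a) ((t b == x)%:R * (x == y)%:R + r * ((t b == x)%:R * (o b == y)%:R)).
Proof.
move=> r2; have [eps e2 eE] := edgevec_arc symG a r2; rewrite !eE.
rewrite /Defs.edge big_setU1 ?big_set1 /=; last by rewrite inE eq_sym (inv_neq symG).
rewrite (o_inv symG) (t_inv symG) /arcvec.
have dd (u : X) : (u == x)%:R * (u == y)%:R = (u == x)%:R * (x == y)%:R :> K.
  by case: (eqVneq u x) => [->//|_]; rewrite !mul0r.
rewrite mulrACA -expr2 e2 mul1r mulrDl !mulrDr dd.
rewrite -[r * _ * (r * _)]mulrACA -expr2 r2 mul1r dd.
ring.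
Qed.

Lemma wJedgeE J e : ce J e = s J * w e.
Proof. by case: J; rewrite /wJedge /edge_sign ?mulN1r ?mul1r. Qed.

Lemma wJloopE J x : cl J x = - z + V x - s J * piw t inv w x.
Proof. by case: J; rewrite /wJloop /edge_sign ?mulN1r ?opprK ?mul1r. Qed.

(** With edge weight [s * w], an arc contributes [s * s * w = w] off the diagonal and [s * w] on it;
    the latter add up to [s * piw], which the loop weight cancels. *)
Lemma network_MV J p x y : x \notin dX ->
  network o t inv (s J) (ce J) (cl J) dX p x y = MV o t inv w V x y - (x == y)%:R * z.
Proof.
move=> xD; rewrite /network (negPf xD).
have -> : \sum_(e in Eset inv) ce J e * edgevec o t (s J) e x * edgevec o t (s J) e y =
    (x == y)%:R * (s J * piw t inv w x)
      + \sum_(a | (t a == x) && (o a == y)) w (edge a).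
  transitivity (\sum_(e in Eset inv) ce J e * (\sum_(b in e)
     ((t b == x)%:R * (x == y)%:R + s J * ((t b == x)%:R * (o b == y)%:R)))).
    apply: eq_bigr => _ /imsetP[a _ ->].
    by rewrite -mulrA (edgevecM _ _ _ (edge_sign2 K J)).
  rewrite sum_edges /piw !mulr_sumr [X in _ = X + _]big_mkcond.
  rewrite [X in _ = _ + X]big_mkcond -big_split /=.
  apply: eq_bigr => a _; rewrite wJedgeE mulrDr.
  rewrite [X in _ + X]mulrACA -expr2 (edge_sign2 K J) mul1r.
  by case: (t a == x); case: (o a == y); case: (x == y); rewrite /=; ring.
by rewrite wJloopE /MV; case: (x == y) => /=; ring.
Qed.

Lemma det_iota1 J :
  \det (\matrix_(i < #|X|, j < #|X|)
    network o t inv (s J) (ce J) (cl J) dX id (enum_val i) (enum_val j)) =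
  iota1 o t inv dX w V J z.
Proof. exact: det_network_id. Qed.

Lemma green_ratio J l m : Mz o t inv dX w V z \in unitmx ->
  iota1 o t inv dX w V J z != 0 /\
  invmx (Mz o t inv dX w V z) l m =
    iota2 o t inv dX w V J z (uenum l) (uenum m) / iota1 o t inv dX w V J z.
Proof.
pose f := network o t inv (s J) (ce J) (cl J) dX id.
have fD x y : x \in dX -> f x y = (x == y)%:R by rewrite /f /network => ->.
have interior (i : 'I_#|~: dX|) : uenum i \notin dX.
  by have := enum_valP i; rewrite in_setC.
have -> : Mz o t inv dX w V z =
    \matrix_(i < #|~: dX|, j < #|~: dX|) f (enum_val i) (enum_val j).
  apply/matrixP => i j; rewrite !mxE /f network_MV ?interior //.
  by rewrite (inj_eq enum_val_inj).
move=> Bu; have Fu := block_unitmx fD Bu.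
rewrite (block_invmx fD _ _ Bu); set M := \matrix_(i < #|X|, j < #|X|) f _ _ in Fu *.
have detM : \det M = iota1 o t inv dX w V J z := det_iota1 J.
have nz : iota1 o t inv dX w V J z != 0 by rewrite -detM -unitfE -unitmxE.
split => //; rewrite /invmx Fu !mxE detM mulrC; congr (_ / _).
have swapE : _ = iota2 o t inv dX w V J z (uenum l) (uenum m) :=
  det_network_swap symG J (ce J) (cl J) (interior l) (interior m).
rewrite -/(uenum l) -/(uenum m) -swapE.
set M' := \matrix_(i, j) _; set i := enum_rank (uenum m).
(* Only column [l] survives in row [m], leaving the cofactor of [M] at [(m, l)], which is the
   adjugate entry at [(l, m)]. *)
rewrite (expand_det_row M' i) (bigD1 (enum_rank (uenum l))) //= big1 => [|k kl].
  rewrite !mxE !enum_rankK /network setU11 !eqxx mul1r addr0.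
  congr (_ * \det _); apply/matrixP => a b; rewrite !mxE /f /network.
  have xm : (enum_val (lift i a) == uenum m) = false.
    rewrite -(inj_eq enum_rank_inj) enum_valK; apply/negbTE.
    by rewrite eq_sym neq_lift.
  by rewrite in_setU1 xm.
rewrite !mxE enum_rankK /network setU11 eqxx.
case: (uenum l =P enum_val k) kl => [->|_]; last by rewrite mul0r.
by rewrite enum_valK eqxx.
Qed.

End Green.

Theorem mainTheorem1 (X A : finType) (o t : A -> X) (inv : A -> A)
  (dX : {set X}) (R : realType) (w : {set A} -> R[i]) (V : X -> R[i]) (z : R[i]) :
  symmetric_digraph o t inv ->
  connected_graph o t ->
  dX \proper [set: X] ->
  Mz o t inv dX w V z \in unitmx ->
  [/\ iota1 o t inv dX w V true z != 0,
      iota1 o t inv dX w V false z != 0 &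
      forall l m : 'I_#|~: dX|,
        let G := invmx (Mz o t inv dX w V z) in
        G l m = iota2 o t inv dX w V true z (uenum l) (uenum m)
                  / iota1 o t inv dX w V true z /\
        G l m = iota2 o t inv dX w V false z (uenum l) (uenum m)
                  / iota1 o t inv dX w V false z].
Proof.
move=> symG _ /properP[_ [u _ uD]] Mu.
have uC : u \in ~: dX by rewrite in_setC.
(* [green_ratio] gives nonvanishing together with an entry, so an interior index is required;
   properness of [dX] supplies it. *)
pose l0 := enum_rank_in uC u.
have ratio J l m := green_ratio symG J l m Mu.
split; first by case: (ratio true l0 l0).
  by case: (ratio false l0 l0).
by move=> l m G; split; case: (ratio true l m) => _; case: (ratio false l m).
Qed.
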